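(* Let $n\ge1$ and let $h=h(t,x)$ be a smooth solution on $[0,T]\times\mathbf{T}^n$ of $\partial_t h+G(h)h=0$. Then $$\Delta_{t,x}h+B(h)^*\big(|\nabla_{t,x}h|^2\big)=0,$$ where $\Delta_{t,x}=\partial_t^2+\Delta_x$, $|\nabla_{t,x}h|^2=(\partial_t h)^2+|\nabla_x h|^2$, and $B(h)^*$ is the adjoint, for the $L^2(\mathbf{T}^n)$ scalar product, of the operator $B(h)$ (applied at each fixed time).
   Context: $\mathbf{T}^n$ denotes an $n$-dimensional torus. For a function $h$ on $\mathbf{T}^n$ (time being a parameter), let $\Omega=\{(x,y)\in\mathbf{T}^n\times\mathbf{R}: y<h(x)\}$. For a function $\psi$ on $\mathbf{T}^n$, let $\varphi$ be its harmonic extension: $\Delta_{x,y}\varphi=0$ in $\Omega$, $\varphi|_{y=h}=\psi$. Define the Dirichlet-to-Neumann operator $G(h)\psi(x)=\partial_y\varphi(x,h(x))-\nabla h(x)\cdot\nabla_x\varphi(x,h(x))$ and the operator $B(h)\psi(x)=\partial_y\varphi(x,h(x))$. A smooth solution means a solution of $\partial_t h+G(h)h=0$ which is $C^\infty$ in $(t,x)$. *)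

(* Defs.v *)
From HB Require Import structures.
From mathcomp Require Import all_boot all_order all_algebra.
From mathcomp Require Import all_classical all_reals all_analysis.
Set Implicit Arguments. Unset Strict Implicit. Unset Printing Implicit Defensive.
Import Order.TTheory GRing.Theory Num.Theory.
Import numFieldNormedType.Exports.
Local Open Scope classical_set_scope.
Local Open Scope ring_scope.

Definition ww_iterD (R : realType) (V : normedModType R) (vs : seq V) (f : V -> R)
  : V -> R :=
  foldr (fun v g => fun x => derive g x v) f vs.

Definition ww_smooth (R : realType) (V : normedModType R) (f : V -> R) : Prop :=
  forall (vs : seq V) (x : V), differentiable (ww_iterD vs f) x.

Definition ww_ei (R : realType) (n : nat) (i : 'I_n) : 'rV[R]_n := delta_mx 0 i.
Arguments ww_ei {R n} i.

(* functions on the torus T^n = R^n / Z^n, seen as Z^n-ww_periodic functions on R^n *)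
Definition ww_periodic (R : realType) (n : nat) (f : 'rV[R]_n -> R) : Prop :=
  forall (i : 'I_n) (x : 'rV[R]_n), f (x + ww_ei i) = f x.

(* integral over the torus: iterated Lebesgue integral over [0,1]^n *)
Fixpoint ww_tint (R : realType) (n : nat) : ('rV[R]_n -> R) -> R :=
  match n return ('rV[R]_n -> R) -> R with
  | 0 => fun f => f 0
  | m.+1 => fun f =>
      Rintegral (@lebesgue_measure R) `[0%R, 1%R]%classic
        (fun s : R => @ww_tint R m (fun x : 'rV[R]_m => f (row_mx (s%:M) x)))
  end.

Definition ww_dx (R : realType) (n : nat) (i : 'I_n) (f : 'rV[R]_n * R -> R)
  (p : 'rV[R]_n * R) : R := derive f p (ww_ei i, 0).
Definition ww_dy (R : realType) (n : nat) (f : 'rV[R]_n * R -> R)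
  (p : 'rV[R]_n * R) : R := derive f p (0, 1).
Definition ww_lap_xy (R : realType) (n : nat) (f : 'rV[R]_n * R -> R)
  (p : 'rV[R]_n * R) : R :=
  \sum_(i < n) ww_dx i (ww_dx i f) p + ww_dy (ww_dy f) p.

(* phi is a harmonic extension of psi to Omega = {(x,y) : y < h x}:
   phi is ww_smooth (up to the boundary), ww_periodic in x, harmonic in Omega,
   bounded in Omega, and equal to psi on the boundary y = h x. *)
Definition ww_harmonic_ext (R : realType) (n : nat) (h psi : 'rV[R]_n -> R)
  (phi : 'rV[R]_n * R -> R) : Prop :=
  [/\ ww_smooth phi,
      (forall (i : 'I_n) x y, phi (x + ww_ei i, y) = phi (x, y)),
      (forall x y, y < h x -> ww_lap_xy phi (x, y) = 0),
      (exists M : R, forall x y, y < h x -> `|phi (x, y)| <= M)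
    & (forall x, phi (x, h x) = psi x)].

Definition ww_px (R : realType) (n : nat) (i : 'I_n) (f : 'rV[R]_n -> R)
  (x : 'rV[R]_n) : R := derive f x (ww_ei i).

(* Dirichlet-to-Neumann: G(h)psi computed from a harmonic extension phi of psi *)
Definition ww_DN (R : realType) (n : nat) (h : 'rV[R]_n -> R)
  (phi : 'rV[R]_n * R -> R) (x : 'rV[R]_n) : R :=
  ww_dy phi (x, h x) - \sum_(i < n) ww_px i h x * ww_dx i phi (x, h x).

(* B(h)psi computed from a harmonic extension phi of psi *)
Definition ww_Bop (R : realType) (n : nat) (h : 'rV[R]_n -> R)
  (phi : 'rV[R]_n * R -> R) (x : 'rV[R]_n) : R := ww_dy phi (x, h x).

Definition ww_dt (R : realType) (n : nat) (f : R * 'rV[R]_n -> R)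
  (p : R * 'rV[R]_n) : R := derive f p (1, 0).
Definition ww_dxt (R : realType) (n : nat) (i : 'I_n) (f : R * 'rV[R]_n -> R)
  (p : R * 'rV[R]_n) : R := derive f p (0, ww_ei i).
Definition ww_lap_tx (R : realType) (n : nat) (f : R * 'rV[R]_n -> R)
  (p : R * 'rV[R]_n) : R :=
  ww_dt (ww_dt f) p + \sum_(i < n) ww_dxt i (ww_dxt i f) p.
Definition ww_gradsq_tx (R : realType) (n : nat) (f : R * 'rV[R]_n -> R)
  (p : R * 'rV[R]_n) : R :=
  (ww_dt f p) ^+ 2 + \sum_(i < n) (ww_dxt i f p) ^+ 2.

(* Main.v *)
(* The identity is tested against the harmonic extension Phi of psi at a fixed
   time t0.  No regularity in t of the extension phi_t of h(t) is needed: Green's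
   identity between phi_t and the translate Phi(x, y - c (t - t0)), which for |c|
   large is harmonic below the graph of h(t) on one side of t0, yields a function of
   t that involves only h and Phi and vanishes on that side, so that its derivative
   at t0 is zero.  The constant c is eliminated by the conservation law attached to
   vertical translations, \int (1 + h_t) Phi_y = 0, and the spatial terms come from
   integrating by parts on the torus.
   The flux of a divergence-free field built from gradients of bounded harmonic
   functions f through the graph of h is zero: deforming the graph to y = -N does not
   change it, and it tends to 0 along a sequence N -> oo, because \int f^2(., y) is
   convex and bounded as y -> -oo with second derivative 2 \int |grad f|^2. *)
Require Import Defs.
From HB Require Import structures.
From mathcomp Require Import all_boot all_order all_algebra.
From mathcomp Require Import all_classical all_reals all_analysis.
From mathcomp Require Import ring lra.
Set Implicit Arguments.
Unset Strict Implicit.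
Unset Printing Implicit Defensive.
Import Order.TTheory GRing.Theory Num.Theory.
Import numFieldNormedType.Exports.
Local Open Scope classical_set_scope.
Local Open Scope ring_scope.

(** At a time [s] other than [t0] the graph of [h(s)] may rise above that of [h(t0)], where Phi need
    not be harmonic. A shift at a speed [c] at least the Lipschitz constant of [h] in time repairs
    this for [s >= t0]; at [t0 = T] only earlier times are available, and the speed changes sign. A
    zero on one side is enough, because [h] is smooth in all real times and the function of [s] has
    a two-sided derivative. The price is the factor (h_t - c)(1 + h_t) in front of Phi_y. Adding c -
    1 times the conservation law turns it into h_t^2 - 1, whatever [c] is, and the term -1 is
    compensated by the zero flux of grad Phi. The conservation law comes from F = phi - y, where phi
    extends [h]: F is harmonic and vanishes on the graph, so its gradient there is normal, with
    unnormalised normal derivative G(h)h - 1 = -(1 + h_t). The flux of the stress-energy field of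
    the pair (F, Phi) thus reduces to -(1 + h_t) Phi_y. *)

Lemma continuous_pair (U V W : topologicalType) (f : U -> V) (g : U -> W) :
  continuous f -> continuous g -> continuous (fun x => (f x, g x)).
Proof.
by move=> cf cg x; apply: cvg_pair; [exact: cf|exact: cg].
Qed.

Lemma continuous_compT (U V W : topologicalType) (f : U -> V) (g : V -> W) :
  continuous f -> continuous g -> continuous (fun x => g (f x)).
Proof. by move=> cf cg x; apply: (@continuous_comp _ _ _ f g); [exact: cf|exact: cg]. Qed.

(** * The integral over the unit interval and its dependence on parameters *)

Definition int01 (R : realType) (f : R -> R) : R :=
  Rintegral (@lebesgue_measure R) `[0%R, 1%R]%classic f.

Section int01.
Context {R : realType}.
Implicit Types f g : R -> R.
Local Notation mu := (@lebesgue_measure R).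

Lemma integrable01 f : continuous f -> mu.-integrable `[0, 1] (EFin \o f).
Proof.
move=> cf; apply: (continuous_compact_integrable (f := f)).
  exact: segment_compact.
exact: continuous_subspaceT.
Qed.

Lemma lebesgue01 : fine (mu `[0, 1]%classic) = 1.
Proof. by rewrite lebesgue_measure_itv /= lte_fin ltr01 -EFinB /= subr0. Qed.

Lemma int01_cst c : int01 (fun _ : R => c) = c.
Proof.
by rewrite /int01 Rintegral_cst // lebesgue01 mulr1.
Qed.

Lemma int01D f g : continuous f -> continuous g ->
  int01 (fun x => f x + g x) = int01 f + int01 g.
Proof. by move=> cf cg; apply: RintegralD => //; exact: integrable01. Qed.

Lemma int01Z c f : continuous f -> int01 (fun x => c * f x) = c * int01 f.
Proof. by move=> cf; apply: RintegralZl => //; exact: integrable01. Qed.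

Lemma int01_le f g : continuous f -> continuous g ->
  (forall x, 0 <= x <= 1 -> f x <= g x) -> int01 f <= int01 g.
Proof.
by move=> cf cg fg; apply: le_Rintegral => //; exact: integrable01.
Qed.

Lemma int01_dist_le (e : R) f g : continuous f -> continuous g ->
  (forall x, 0 <= x <= 1 -> `|f x - g x| <= e) -> `|int01 f - int01 g| <= e.
Proof.
move=> cf cg fg; have ce : continuous (fun _ : R => e) by move=> x; exact: cvg_cst.
have shift (u v : R -> R) : continuous u -> continuous v ->
    (forall x, 0 <= x <= 1 -> u x <= v x + e) -> int01 u <= int01 v + e.
  move=> cu cv uv; rewrite -[X in _ <= _ + X]int01_cst -int01D//; apply: int01_le => // x.
  by apply: cvgD; [exact: cv|exact: ce].
have fge : int01 f <= int01 g + e.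
  by apply: shift => // x /fg; rewrite ler_norml => /andP[]; lra.
have gfe : int01 g <= int01 f + e.
  by apply: shift => // x /fg; rewrite ler_norml => /andP[]; lra.
by rewrite ler_norml; apply/andP; split; lra.
Qed.

Lemma int01_FTC (F f : R -> R) : continuous f ->
  (forall x : R, is_derive x (1 : R) F (f x)) -> int01 f = F 1 - F 0.
Proof.
move=> cf dF.
have cF : continuous F.
  by move=> x; apply: differentiable_continuous; apply/derivable1_diffP; have [] := dF x.
rewrite /int01 /Rintegral (@continuous_FTC2 _ f F 0 1) //.
- exact: continuous_subspaceT.
- split.
  + by move=> x _; have [] := dF x.
  + exact: cvg_at_right_filter (cF 0).
  + exact: cvg_at_left_filter (cF 1).
- by move=> x _; rewrite derive1E; have [] := dF x.
Qed.

(** Compactness of [0, 1] makes the joint continuity of [K] uniform in [s] for [u] near [u0]. The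
    parameter space is an arbitrary topological space, so that products of times, heights and torus
    points can serve as parameters. *)
Lemma int01_param (U : topologicalType) (K : U * R -> R) :
  continuous K -> continuous (fun u => int01 (fun s => K (u, s))).
Proof.
move=> cK u0.
have cKu u : continuous (fun s => K (u, s)).
  by apply: continuous_compT cK; apply: continuous_pair => s; [exact: cvg_cst|exact: cvg_id].
apply/cvgrPdist_le => e e0.
have e2 : 0 < e / 2 by lra.
have cpt : compact (`[0, 1]%classic : set R) by exact: segment_compact.
move/compact_near_coveringP : cpt => cpt.
have H : \forall u \near u0, `[0,1]%classic `<=` (fun s => `|K (u0, s) - K (u, s)| < e).
  apply: (cpt _ (nbhs u0) (fun u s => `|K (u0, s) - K (u, s)| < e)) => s _.
  move/cvgrPdist_lt : (cK (u0, s)) => /(_ _ e2) [[A B] /= [nA nB] AB].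
  move/cvgrPdist_lt : (cKu u0 s) => /(_ _ e2) nC.
  exists (B `&` [set x | `|K (u0, s) - K (u0, x)| < e / 2], A) => /=.
    by split => //; apply: filterI.
  move=> [x u] /= [[Bx Cx] Au]; have {}AB := AB (u, x) (conj Au Bx).
  rewrite /= in AB.
  have -> : K (u0, x) - K (u, x) = (K (u0, s) - K (u, x)) - (K (u0, s) - K (u0, x)) by ring.
  by rewrite (le_lt_trans (ler_normB _ _))// (_ : e = e / 2 + e / 2); [exact: ltrD|lra].
near=> u.
have H1 : forall s, 0 <= s <= 1 -> `|K (u0, s) - K (u, s)| <= e.
  move=> s s01; apply/ltW; have : (`[0,1]%classic `<=` (fun s => `|K (u0, s) - K (u, s)| < e)).
    by near: u.
  by apply; rewrite /= in_itv.
exact: int01_dist_le.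
Unshelve. all: by end_near.
Qed.
End int01.

Lemma continuous_pair_cstl (U V : topologicalType) (u : U) : continuous (fun v : V => (u, v)).
Proof. by apply: continuous_pair => v; [exact: cst_continuous|exact: cvg_id]. Qed.

(** * Differentiation under the integral sign *)

Section param_linear.
Context {R : realType}.

(* Satisfied both by the integral over [0, 1] and by the integral over the torus. *)
Definition param_linear (X : topologicalType) (J : (X -> R) -> R) : Prop :=
  [/\ forall (U : topologicalType) (K : U * X -> R), continuous K ->
        continuous (fun u => J (fun x => K (u, x))),
      forall f g, continuous f -> continuous g ->
        J (fun x => f x + g x) = J f + J g
    & forall (c : R) f, continuous f -> J (fun x => c * f x) = c * J f].

Lemma param_linear_int01 : param_linear (@int01 R : (R -> R) -> R).
Proof.
split; [exact: int01_param|exact: int01D|exact: int01Z].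
Qed.

(** Carathéodory's form of the derivative: the difference quotient is [g a] itself, so its limit is
    a matter of continuity of [g] at 0. *)
Lemma is_derive_slope (f g : R -> R) (s : R) : {for 0, continuous g} ->
  (forall a, f (a + s) - f s = a * g a) -> is_derive s (1 : R) f (g 0).
Proof.
move=> cg fg.
have H : h^-1 *: (f (h *: 1 + s) - f s) @[h --> (0:R)^'] --> g 0.
  have cg' : g a @[a --> (0:R)^'] --> g 0 by apply: cvg_within_filter; exact: cg.
  apply: cvg_trans cg'; apply: near_eq_cvg; near=> h.
  rewrite [h *: 1]mulr1 fg [RHS]mulrA mulVf ?mul1r//.
  by near: h; exact: nbhs_dnbhs_neq.
split; first by apply/cvg_ex; exists (g 0).
exact: cvg_lim.
Unshelve. all: by end_near.
Qed.

(** Hadamard's factorisation of an increment. The second factor makes sense at [a = 0] and inherits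
    continuity in any further parameter, which prepares the use of [is_derive_slope]. *)
Lemma FTC_slope (F f : R -> R) (s a : R) : continuous f ->
  (forall x : R, is_derive x (1 : R) F (f x)) ->
  F (a + s) - F s = a * int01 (fun r => f (r * a + s)).
Proof.
move=> cf dF.
have cg : continuous (fun r : R => f (r * a + s)).
  apply: continuous_compT cf => r.
  by apply: cvgD; [apply: cvgM; [exact: cvg_id|exact: cvg_cst]|exact: cvg_cst].
rewrite -int01Z//.
have -> : F (a + s) - F s = F (1 * a + s) - F (0 * a + s) by rewrite mul1r mul0r add0r.
symmetry; apply: (@int01_FTC _ (fun r => F (r * a + s))).
  by move=> r; apply: cvgM; [exact: cvg_cst|exact: cg].
move=> r.
have dg : is_derive r (1 : R) (fun r : R => r * a + s) a.
  apply: (@is_derive_slope _ (fun _ => a)) => [|b]; first exact: cvg_cst.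
  by ring.
rewrite mulrC; exact: (@is_derive1_comp _ F (fun r => r * a + s) r _ _ (dF (r * a + s)) dg).
Qed.

(** No dominated convergence is involved: each increment in [s] is [a] times a jointly continuous
    [H (a, x)], linearity takes [a] out of [J], and continuity of [J] in parameters gives the limit
    at [a = 0]. *)
Lemma is_derive_param (X : topologicalType) (J : (X -> R) -> R) (K K' : R * X -> R) :
  param_linear J -> continuous K -> continuous K' ->
  (forall x (s : R), is_derive s (1 : R) (fun s => K (s, x)) (K' (s, x))) ->
  forall s : R, is_derive s (1 : R) (fun s => J (fun x => K (s, x))) (J (fun x => K' (s, x))).
Proof.
move=> [Jc JD JZ] cK cK' dK s.
have cK's x : continuous (fun s => K' (s, x)).
  by apply: continuous_compT cK'; apply: continuous_pair => ?; [exact: cvg_id|exact: cvg_cst].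
have sl x a := FTC_slope s a (cK's x) (dK x).
pose H (p : R * X) := int01 (fun r => K' (r * p.1 + s, p.2)).
have cH : continuous H.
  apply: (@int01_param R _ (fun q : R * X * R => K' (q.2 * q.1.1 + s, q.1.2))).
  apply: continuous_compT cK'; apply: continuous_pair => q; last first.
    by apply: (@cvg_comp _ _ _ fst snd); [exact: cvg_fst|exact: cvg_snd].
  apply: cvgD; last exact: cvg_cst.
  apply: cvgM; first exact: cvg_snd.
  by apply: (@cvg_comp _ _ _ fst fst); [exact: cvg_fst|exact: cvg_fst].
have -> : J (fun x => K' (s, x)) = J (fun x => H (0, x)).
  congr J; apply/funext => x; rewrite /H /= -[LHS]int01_cst; congr int01.
  by apply/funext => r; rewrite mulr0 add0r.
apply: (@is_derive_slope _ (fun a => J (fun x => H (a, x)))); first exact: Jc.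
have c2 (L : R * X -> R) b : continuous L -> continuous (fun x => L (b, x)).
  by move=> cL; apply: continuous_compT cL; exact: continuous_pair_cstl.
move=> a; rewrite -JZ; last exact: c2.
have -> : (fun x => K (a + s, x)) = (fun x => K (s, x) + a * H (a, x)).
  by apply/funext => x; rewrite -[a * H _]sl [RHS]addrC subrK.
rewrite JD ?JZ; [by rewrite addrAC subrr add0r|exact: c2|exact: c2|].
by move=> x; apply: cvgM; [exact: cvg_cst|exact: c2].
Qed.
End param_linear.

Lemma continuous_mx (R : realType) (U : topologicalType) m n (f : U -> 'M[R]_(m, n)) :
  (forall i j, continuous (fun u => f u i j)) -> continuous f.
Proof.
move=> cf u; apply/cvg_ballP => e e0.
have : \forall v \near u, forall ij : 'I_m * 'I_n, ball (f u ij.1 ij.2) e (f v ij.1 ij.2).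
  apply: filter_forall => -[i j] /=.
  by have /cvg_ballP := cf i j u; apply.
by apply: filterS => v H; split => // i j; exact: (H (i, j)).
Qed.


Lemma continuousD_fun (R : realType) (U : topologicalType) (f g : U -> R) :
  continuous f -> continuous g -> continuous (fun u => f u + g u).
Proof. by move=> cf cg u; apply: cvgD; [exact: cf|exact: cg]. Qed.

Lemma continuousN_fun (R : realType) (U : topologicalType) (f : U -> R) :
  continuous f -> continuous (fun u => - f u).
Proof. by move=> cf u; apply: cvgN; exact: cf. Qed.

Lemma continuousB_fun (R : realType) (U : topologicalType) (f g : U -> R) :
  continuous f -> continuous g -> continuous (fun u => f u - g u).
Proof. by move=> cf cg; exact/continuousD_fun/continuousN_fun. Qed.

Lemma continuousM_fun (R : realType) (U : topologicalType) (f g : U -> R) :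
  continuous f -> continuous g -> continuous (fun u => f u * g u).
Proof. by move=> cf cg u; apply: cvgM; [exact: cf|exact: cg]. Qed.

Lemma continuous_sum_fun (R : realType) (U : topologicalType) (I : Type) (r : seq I)
    (F : I -> U -> R) :
  (forall i, continuous (F i)) -> continuous (fun u => \sum_(i <- r) F i u).
Proof.
move=> cF; elim: r => [|i r IH].
  rewrite (_ : (fun _ => _) = fun _ => 0); first exact: cst_continuous.
  by apply/funext => u; rewrite big_nil.
rewrite (_ : (fun _ => _) = fun u => F i u + \sum_(j <- r) F j u).
  by move=> u; apply: cvgD; [exact: cF|exact: IH].
by apply/funext => u; rewrite big_cons.
Qed.

(** * The iterated integral over the torus *)

Section tint.
Context {R : realType}.

Lemma continuous_row_mx m :
  continuous (fun p : R * 'rV[R]_m => row_mx p.1%:M p.2 : 'rV[R]_(1 + m)).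
Proof.
apply: continuous_mx => i j p.
have [k|k] := splitP j => jk.
  have -> : j = lshift m k by apply/val_inj.
  rewrite (_ : (fun _ => _) = (fun p : R * 'rV[R]_m => p.1)).
    exact: cvg_fst.
  by apply/funext => q; rewrite row_mxEl mxE !ord1 eqxx mulr1n.
have -> : j = rshift 1 k by apply/val_inj.
rewrite (_ : (fun _ => _) = (fun p : R * 'rV[R]_m => p.2 i k)).
  by apply: continuous_compT (@coord_continuous _ _ _ i k) _ => q; exact: cvg_snd.
by apply/funext => q; rewrite row_mxEr.
Qed.

Lemma continuous_row_slice m (f : 'rV[R]_m.+1 -> R) (s : R) : continuous f ->
  continuous (fun x : 'rV[R]_m => f (row_mx s%:M x)).
Proof.
move=> cf; apply: continuous_compT cf.
apply: (@continuous_compT _ _ _ (fun x => (s, x))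
  (fun p : R * 'rV[R]_m => row_mx p.1%:M p.2 : 'rV[R]_m.+1)); last exact: continuous_row_mx.
exact: continuous_pair_cstl.
Qed.

(** In the induction the outer integrand is itself an inner integral, with parameter [(u, s)]. This
    is why continuity must be carried along for every parameter space at once. *)
Lemma param_linear_tint n : param_linear (@ww_tint R n).
Proof.
elim: n => [|m [IHc IHD IHZ]].
  split=> // U K cK; apply: continuous_compT cK.
  by apply: continuous_pair => u; [exact: cvg_id|exact: cvg_cst].
have cin (U : topologicalType) (K : U * 'rV[R]_m.+1 -> R) : continuous K ->
    continuous (fun p : U * R => ww_tint (fun x : 'rV[R]_m => K (p.1, row_mx p.2%:M x))).
  move=> cK; apply: (IHc _ (fun q => K (q.1.1, row_mx q.1.2%:M q.2))).
  apply: continuous_compT cK; apply: continuous_pair.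
    by apply: (@continuous_compT _ _ _ fst fst) => q; exact: cvg_fst.
  apply: (@continuous_compT _ _ _ (fun q : U * R * 'rV[R]_m => (q.1.2, q.2))
    (fun p : R * 'rV[R]_m => row_mx p.1%:M p.2 : 'rV[R]_m.+1)); last exact: continuous_row_mx.
  apply: continuous_pair; last by move=> q; exact: cvg_snd.
  by apply: (@continuous_compT _ _ _ fst snd) => q; [exact: cvg_fst|exact: cvg_snd].
have cin0 (f : 'rV[R]_m.+1 -> R) : continuous f ->
    continuous (fun s : R => ww_tint (fun x : 'rV[R]_m => f (row_mx s%:M x))).
  move=> cf; apply: (IHc _ (fun q => f (row_mx q.1%:M q.2))).
  by apply: continuous_compT cf; exact: continuous_row_mx.
split.
- by move=> U K cK; exact: (int01_param (cin U K cK)).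
- move=> f g cf cg /=; rewrite -int01D; [|exact: cin0|exact: cin0].
  by congr int01; apply/funext => s; rewrite IHD //; exact: continuous_row_slice.
- move=> c f cf /=; rewrite -int01Z; last exact: cin0.
  by congr int01; apply/funext => s; rewrite IHZ //; exact: continuous_row_slice.
Qed.

Lemma continuous_tint_param n (U : topologicalType) (K : U * 'rV[R]_n -> R) :
  continuous K -> continuous (fun u => ww_tint (fun x => K (u, x))).
Proof. by have [+ _ _] := param_linear_tint n; exact. Qed.

Lemma tintD n (f g : 'rV[R]_n -> R) : continuous f -> continuous g ->
  ww_tint (fun x => f x + g x) = ww_tint f + ww_tint g.
Proof. by have [_ + _] := param_linear_tint n; exact. Qed.

Lemma tintZ n c (f : 'rV[R]_n -> R) : continuous f ->
  ww_tint (fun x => c * f x) = c * ww_tint f.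
Proof. by have [_ _] := param_linear_tint n; exact. Qed.

Lemma continuous_tint_slice m (f : 'rV[R]_m.+1 -> R) : continuous f ->
  continuous (fun s : R => ww_tint (fun x : 'rV[R]_m => f (row_mx s%:M x))).
Proof.
move=> cf; apply: (@continuous_tint_param _ _ (fun q => f (row_mx q.1%:M q.2))).
by apply: continuous_compT cf; exact: continuous_row_mx.
Qed.

Lemma tintS m (f : 'rV[R]_m.+1 -> R) :
  ww_tint f = int01 (fun s => ww_tint (fun x : 'rV[R]_m => f (row_mx s%:M x))).
Proof. by []. Qed.

Lemma tint_cst n c : ww_tint (fun _ : 'rV[R]_n => c) = c.
Proof. by elim: n => // n IH; rewrite tintS IH int01_cst. Qed.

Definition cube n : set 'rV[R]_n := [set x | forall i, 0 <= x ord0 i <= 1].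

Lemma compact_cube n : compact (@cube n).
Proof.
have := @rV_compact R n (fun=> `[0, 1]%classic) (fun=> @segment_compact R 0 1).
by congr compact; apply/seteqP; split => x H i; have := H i; rewrite /= in_itv.
Qed.

Lemma cube0 n : cube (0 : 'rV[R]_n).
Proof. by move=> i; rewrite mxE lexx ler01. Qed.

Lemma cube_row_mx m (s : R) (x : 'rV[R]_m) : 0 <= s <= 1 -> cube x ->
  cube (row_mx s%:M x : 'rV[R]_m.+1).
Proof.
move=> s01 cx i; rewrite -[i]/(i : 'I_(1 + m)) mxE; case: splitP => k _.
  by rewrite mxE !ord1 eqxx mulr1n.
exact: cx.
Qed.

Lemma tint_le n (f g : 'rV[R]_n -> R) : continuous f -> continuous g ->
  (forall x, cube x -> f x <= g x) -> ww_tint f <= ww_tint g.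
Proof.
elim: n f g => [|n IH] f g cf cg fg; first exact/fg/cube0.
rewrite !tintS; apply: int01_le; [exact: continuous_tint_slice..|].
move=> s s01; apply: IH; [exact: continuous_row_slice..|].
by move=> x cx; apply: fg; exact: cube_row_mx.
Qed.

(** Harmonicity will be known only above points of the cube, so integrands can be compared only
    there. *)
Lemma eq_tint_cube n (f g : 'rV[R]_n -> R) : continuous f -> continuous g ->
  (forall x, cube x -> f x = g x) -> ww_tint f = ww_tint g.
Proof.
by move=> cf cg fg; apply/eqP; rewrite eq_le; apply/andP; split; apply: tint_le => // x cx;
  rewrite fg.
Qed.

Lemma tintN n (f : 'rV[R]_n -> R) : continuous f -> ww_tint (fun x => - f x) = - ww_tint f.
Proof.
by move=> cf; rewrite -mulN1r -tintZ//; congr ww_tint; apply/funext => x; rewrite mulN1r.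
Qed.

Lemma tint_sum n (I : finType) (F : I -> 'rV[R]_n -> R) : (forall i, continuous (F i)) ->
  ww_tint (fun x => \sum_i F i x) = \sum_i ww_tint (F i).
Proof.
move=> cF; rewrite -[LHS]/(ww_tint (fun x => \sum_i F i x)).
elim: (index_enum I) => [|i s IH].
  rewrite big_nil -[RHS](tint_cst n); congr ww_tint; apply/funext => x; exact: big_nil.
rewrite big_cons -IH -tintD//.
  by congr ww_tint; apply/funext => x; rewrite big_cons.
by apply: continuous_sum_fun.
Qed.

Lemma tint_abs_le n (f g : 'rV[R]_n -> R) : continuous f -> continuous g ->
  (forall x, cube x -> `|f x| <= g x) -> `|ww_tint f| <= ww_tint g.
Proof.
move=> cf cg fg; rewrite ler_norml -tintN//; apply/andP; split; apply: tint_le => //.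
- exact: continuousN_fun.
- by move=> x /fg; rewrite ler_norml => /andP[].
- by move=> x /fg; rewrite ler_norml => /andP[].
Qed.
End tint.

(** * Integrals of derivatives of periodic functions *)

Section derivatives.
Context {R : realType}.

Lemma is_derive_curve (V : normedModType R) (f : V -> R) (c : R -> V) (v : V) (s : R) :
  (forall a, c (a + s) = a *: v + c s) -> derivable f (c s) v ->
  is_derive s (1 : R) (fun s => f (c s)) ('D_v f (c s)).
Proof.
move=> cs df.
have e : (fun h : R => h^-1 *: (f (c (h *: 1 + s)) - f (c s))) =
         (fun h : R => h^-1 *: (f (h *: v + c s) - f (c s))).
  by apply/funext => h; rewrite [h *: 1]mulr1 cs.
by split; rewrite /derivable /derive /= e.
Qed.

(** The order of integration is never exchanged. For the first coordinate, the derivative is taken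
    out of the inner integral and the outer one is evaluated between endpoints that agree by
    periodicity. For any other coordinate, the inner integral vanishes on each slice by
    induction. *)
Lemma tint_derive_periodic n (f : 'rV[R]_n -> R) (i : 'I_n) :
  continuous f -> (forall x, derivable f x (ww_ei i)) ->
  continuous ('D_(ww_ei i) f) -> (forall x, f (x + ww_ei i) = f x) ->
  ww_tint ('D_(ww_ei i) f) = 0.
Proof.
elim: n f i => [|n IH] f i cf df cdf pf; first by case: i {df cdf pf}.
rewrite tintS.
have [i0|[j ij]] : i = ord0 \/ exists j : 'I_n, i = lift ord0 j.
- by case: (unliftP ord0 i) => [j ->|->]; [right; exists j|left].
- have e0 : ww_ei i = row_mx 1%:M 0 :> 'rV[R]_(1 + n).
    apply/rowP => k; rewrite !mxE i0 eqxx /=; case: splitP => l kl; rewrite mxE.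
      by rewrite !ord1 (_ : k = ord0) ?eqxx//; apply/val_inj; rewrite /= kl ord1.
    by rewrite (_ : k == ord0 = false)//; apply/eqP => /(congr1 val); rewrite /= kl.
  pose K (p : R * 'rV[R]_n) := f (row_mx p.1%:M p.2).
  have -> : int01 (fun s : R => ww_tint (fun x : 'rV_n => ('D_(ww_ei i) f) (row_mx s%:M x))) =
      ww_tint (fun x => K (1, x)) - ww_tint (fun x => K (0, x)); last first.
  + rewrite (_ : (fun x => K (1, x)) = (fun x => K (0, x))) ?subrr//.
    apply/funext => x; rewrite /K /= -(pf (@row_mx R 1 1 n 0%:M x)) e0; congr f.
    rewrite -[RHS]/(@row_mx R 1 1 n 0%:M x + row_mx 1%:M 0).
    by rewrite add_row_mx addr0 -raddfD /= add0r.
  apply: (@int01_FTC _ (fun s => ww_tint (fun x => K (s, x)))).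
  + exact: (continuous_tint_slice cdf).
  + apply: (is_derive_param (J := @ww_tint R n) (K := K)
      (K' := fun p => 'D_(ww_ei i) f (row_mx p.1%:M p.2)) (param_linear_tint n)).
    * exact: (continuous_compT (@continuous_row_mx R n) cf).
    * exact: (continuous_compT (@continuous_row_mx R n) cdf).
    * move=> x s; apply: (is_derive_curve (c := fun s : R => row_mx s%:M x : 'rV[R]_n.+1)) => //.
      move=> a; rewrite e0 -[RHS]/(a *: @row_mx R 1 1 n 1%:M 0 + row_mx s%:M x).
      by rewrite scale_row_mx add_row_mx scaler0 add0r scale_scalar_mx mulr1 -raddfD.
- have ej : ww_ei i = row_mx 0 (ww_ei j) :> 'rV[R]_(1 + n).
    apply/rowP => k; rewrite !mxE ij eqxx /=; case: splitP => l kl; rewrite mxE.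
      by rewrite (_ : k == _ = false)//; apply/eqP => /(congr1 val); rewrite /= kl ord1.
    rewrite eqxx /=; congr (nat_of_bool _)%:R.
    rewrite (_ : k = lift ord0 l) ?(inj_eq lift_inj)//.
    by apply/val_inj; rewrite /= kl.
  rewrite -[RHS](int01_cst 0); congr int01; apply/funext => s.
  have D x : is_derive x (ww_ei j) (fun x : 'rV[R]_n => f (row_mx s%:M x))
               ('D_(ww_ei i) f (row_mx s%:M x)).
    have e : (fun h : R => h^-1 *: (f (row_mx s%:M (h *: ww_ei j + x)) - f (row_mx s%:M x))) =
         (fun h : R => h^-1 *: (f (h *: ww_ei i + row_mx s%:M x : 'rV[R]_(1 + n)) - f (row_mx s%:M x))).
      apply/funext => h; congr (_ *: (f _ - _)); rewrite ej.
      rewrite -[RHS]/(h *: @row_mx R 1 1 n 0 (ww_ei j) + row_mx s%:M x).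
      by rewrite scale_row_mx add_row_mx scaler0 add0r.
    have [] := (derivableP (df (@row_mx R 1 1 n s%:M x))).
    by rewrite /derivable /derive /= -e => d1 d2; split.
  have De : 'D_(ww_ei j) (fun x : 'rV[R]_n => f (row_mx s%:M x)) =
            fun x => 'D_(ww_ei i) f (row_mx s%:M x).
    by apply/funext => x; have [] := D x.
  rewrite -De; apply: IH.
  + exact: continuous_row_slice.
  + by move=> x; have [] := D x.
  + by rewrite De; exact: (@continuous_row_slice R n ('D_(ww_ei i) f) s cdf).
  + move=> x; rewrite -[RHS](pf (@row_mx R 1 1 n s%:M x)) ej.
    by rewrite -[X in _ = f X]/(@row_mx R 1 1 n s%:M x + row_mx 0 (ww_ei j)) add_row_mx addr0.
Qed.
End derivatives.

(** * Functions of class C1 and C2, and their calculus *)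

Section C1.
Context {R : realType}.
Implicit Types V W : normedModType R.

(** Two derivatives suffice for the whole argument, and closure under products and compositions is
    far easier to prove for these classes than for [ww_smooth], which involves all iterated
    derivatives. *)
Definition C1 V (f : V -> R) : Prop :=
  (forall x, differentiable f x) /\ forall v, continuous ('D_v f).

Lemma C1_differentiable V (f : V -> R) x : C1 f -> differentiable f x.
Proof. by case. Qed.

Lemma C1_derivable V (f : V -> R) x v : C1 f -> derivable f x v.
Proof. by case=> df _; exact: diff_derivable. Qed.

Lemma C1_continuous V (f : V -> R) : C1 f -> continuous f.
Proof. by case=> df _ x; exact: differentiable_continuous. Qed.

Lemma C1_continuousD V (f : V -> R) v : C1 f -> continuous ('D_v f).
Proof. by case. Qed.

Lemma smooth_D V (f : V -> R) v : ww_smooth f -> ww_smooth ('D_v f).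
Proof.
move=> sf vs x; have := sf (rcons vs v) x.
by rewrite /ww_iterD foldr_rcons.
Qed.

Lemma smooth_C1 V (f : V -> R) : ww_smooth f -> C1 f.
Proof.
move=> sf; split=> [x|v x]; first exact: (sf [::] x).
exact: differentiable_continuous (sf [:: v] x).
Qed.

Lemma C1_cst V (c : R) : C1 (fun _ : V => c).
Proof.
split=> [x|v]; first exact: differentiable_cst.
rewrite (_ : 'D_v _ = fun _ => 0); first exact: cst_continuous.
by apply/funext => x; exact: derive_cst.
Qed.

Lemma C1_DD V (f g : V -> R) v x : C1 f -> C1 g ->
  'D_v (fun x => f x + g x) x = 'D_v f x + 'D_v g x.
Proof. by move=> cf cg; apply: (@deriveD _ _ _ f g); exact: C1_derivable. Qed.

Lemma C1_DN V (f : V -> R) v x : C1 f -> 'D_v (fun x => - f x) x = - 'D_v f x.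
Proof. by move=> cf; apply: (@deriveN _ _ _ f); exact: C1_derivable. Qed.

Lemma C1_DM V (f g : V -> R) v x : C1 f -> C1 g ->
  'D_v (fun x => f x * g x) x = 'D_v f x * g x + f x * 'D_v g x.
Proof.
move=> cf cg; rewrite [LHS](@deriveM _ _ f g); [|exact: C1_derivable..].
by rewrite addrC [_ *: _]mulrC.
Qed.

Lemma C1D V (f g : V -> R) : C1 f -> C1 g -> C1 (fun x => f x + g x).
Proof.
move=> cf cg; split=> [x|v].
  by apply: differentiableD; exact: C1_differentiable.
rewrite (_ : 'D_v _ = fun x => 'D_v f x + 'D_v g x).
  by apply: continuousD_fun; exact: C1_continuousD.
by apply/funext => x; exact: C1_DD.
Qed.

Lemma C1N V (f : V -> R) : C1 f -> C1 (fun x => - f x).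
Proof.
move=> cf; split=> [x|v].
  by apply: differentiableN; exact: C1_differentiable.
rewrite (_ : 'D_v _ = fun x => - 'D_v f x).
  by apply: continuousN_fun; exact: C1_continuousD.
by apply/funext => x; exact: C1_DN.
Qed.

Lemma C1B V (f g : V -> R) : C1 f -> C1 g -> C1 (fun x => f x - g x).
Proof. by move=> cf cg; exact/C1D/C1N. Qed.

Lemma C1_DB V (f g : V -> R) v x : C1 f -> C1 g ->
  'D_v (fun x => f x - g x) x = 'D_v f x - 'D_v g x.
Proof. by move=> cf cg; rewrite (C1_DD v x cf (C1N cg)) C1_DN. Qed.

Lemma C1M V (f g : V -> R) : C1 f -> C1 g -> C1 (fun x => f x * g x).
Proof.
move=> cf cg; split=> [x|v].
  by apply: differentiableM; exact: C1_differentiable.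
rewrite (_ : 'D_v _ = fun x => 'D_v f x * g x + f x * 'D_v g x).
  apply: continuousD_fun; apply: continuousM_fun;
    by [exact: C1_continuousD|exact: C1_continuous].
by apply/funext => x; exact: C1_DM.
Qed.

Lemma C1_sum V (I : Type) (r : seq I) (F : I -> V -> R) :
  (forall i, C1 (F i)) -> C1 (fun x => \sum_(i <- r) F i x).
Proof.
move=> cF; elim: r => [|i r IH].
  rewrite (_ : (fun _ => _) = fun _ => 0); first exact: C1_cst.
  by apply/funext => x; rewrite big_nil.
rewrite (_ : (fun _ => _) = fun x => F i x + \sum_(j <- r) F j x); first exact: C1D.
by apply/funext => x; rewrite big_cons.
Qed.

Lemma C1_Dsum V (I : Type) (r : seq I) (F : I -> V -> R) v x :
  (forall i, C1 (F i)) ->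
  'D_v (fun x => \sum_(i <- r) F i x) x = \sum_(i <- r) 'D_v (F i) x.
Proof.
move=> cF; elim: r => [|i r IH].
  rewrite big_nil (_ : (fun _ => _) = fun _ => 0) ?derive_cst//.
  by apply/funext => y; rewrite big_nil.
rewrite big_cons -IH -(C1_DD v x (cF i) (C1_sum r cF)).
by under eq_fun do rewrite big_cons.
Qed.

(** The identity on increments says that [A] is affine with linear part [L]. Slices, swaps, vertical
    shifts and projections are all instances, and no differentiability is required. *)
Lemma derive_affine V W (A L : W -> V) (f : V -> R) w v :
  (forall (h : R) w v, A (h *: v + w) = h *: L v + A w) ->
  'D_v (fun w => f (A w)) w = 'D_(L v) f (A w).
Proof. by move=> AL; rewrite /derive; under eq_fun do rewrite /= AL. Qed.

Lemma C1_affine V W (A L : W -> V) (f : V -> R) :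
  (forall (h : R) w v, A (h *: v + w) = h *: L v + A w) ->
  (forall w, differentiable A w) -> C1 f -> C1 (fun w => f (A w)).
Proof.
move=> AL dA cf; split=> [w|v].
  by apply: (differentiable_comp (dA w)); exact: C1_differentiable.
rewrite (_ : 'D_v _ = fun w => 'D_(L v) f (A w)).
  apply: (@continuous_compT _ _ _ A ('D_(L v) f)); last exact: C1_continuousD.
  move=> {}w.
  exact: differentiable_continuous.
by apply/funext => w; exact: derive_affine.
Qed.

(** The condition [is_diff w a a] makes [a] its own differential, hence linear. It is used with
    [snd] for a graph that moves in time and with the identity for a fixed graph. *)
Lemma derive_graph V W (a : W -> V) (l : W -> R) (X : V * R -> R) v w :
  (forall w, is_diff w a a) -> C1 l -> C1 X ->
  'D_v (fun w => X (a w, l w)) w =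
  'D_(a v, 0) X (a w, l w) + 'D_v l w * 'D_(0, 1) X (a w, l w).
Proof.
move=> da cl cX.
have dl := C1_differentiable w cl; have dX := C1_differentiable (a w, l w) cX.
have dal : differentiable (fun w => (a w, l w)) w by apply: differentiable_pair.
rewrite !deriveE//; last exact: (differentiable_comp dal dX).
rewrite (diff_comp dal dX) /= diff_pair//= diff_val.
rewrite (_ : (a v, 'd l w v) = (a v, 0) + 'd l w v *: (0, 1)) ?linearD ?linearZ//.
by congr (_, _); rewrite /= ?scaler0 ?addr0// add0r [RHS]mulr1.
Qed.

Lemma C1_graph V W (a : W -> V) (l : W -> R) (X : V * R -> R) :
  (forall w, is_diff w a a) -> C1 l -> C1 X -> C1 (fun w => X (a w, l w)).
Proof.
move=> da cl cX; split=> [w|v].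
  apply: (@differentiable_comp _ _ _ _ (fun w => (a w, l w)) X); last exact: C1_differentiable.
  by apply: differentiable_pair => //; exact: C1_differentiable.
rewrite (_ : 'D_v _ = fun w =>
  'D_(a v, 0) X (a w, l w) + 'D_v l w * 'D_(0, 1) X (a w, l w)); last first.
  by apply/funext => w; exact: derive_graph.
have cal : continuous (fun w => (a w, l w)).
  apply: continuous_pair; last exact: C1_continuous.
  by move=> w; exact: differentiable_continuous.
apply: continuousD_fun; first exact: (@continuous_compT _ _ _ _ ('D_(a v, 0) X) cal (C1_continuousD cX)).
apply: continuousM_fun; first exact: C1_continuousD.
exact: (@continuous_compT _ _ _ _ ('D_(0, 1) X) cal (C1_continuousD cX)).
Qed.

Definition C2 V (f : V -> R) : Prop := C1 f /\ forall v, C1 ('D_v f).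

Lemma C2_C1 V (f : V -> R) : C2 f -> C1 f.
Proof. by case. Qed.

Lemma C2_D V (f : V -> R) v : C2 f -> C1 ('D_v f).
Proof. by case. Qed.

Lemma smooth_C2 V (f : V -> R) : ww_smooth f -> C2 f.
Proof. by move=> sf; split=> [|v]; apply: smooth_C1 => //; exact: smooth_D. Qed.

Lemma C2_cst V (c : R) : C2 (fun _ : V => c).
Proof.
split=> [|v]; first exact: C1_cst.
rewrite (_ : 'D_v _ = fun _ => 0); first exact: C1_cst.
by apply/funext => x; exact: derive_cst.
Qed.

Lemma C2D V (f g : V -> R) : C2 f -> C2 g -> C2 (fun x => f x + g x).
Proof.
move=> [cf df] [cg dg]; split=> [|v]; first exact: C1D.
rewrite (_ : 'D_v _ = fun x => 'D_v f x + 'D_v g x); first exact: C1D.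
by apply/funext => x; exact: C1_DD.
Qed.

Lemma C2M V (f g : V -> R) : C2 f -> C2 g -> C2 (fun x => f x * g x).
Proof.
move=> [cf df] [cg dg]; split=> [|v]; first exact: C1M.
rewrite (_ : 'D_v _ = fun x => 'D_v f x * g x + f x * 'D_v g x).
  by apply: C1D; apply: C1M.
by apply/funext => x; exact: C1_DM.
Qed.

Lemma C2_affine V W (A L : W -> V) (f : V -> R) :
  (forall (h : R) w v, A (h *: v + w) = h *: L v + A w) ->
  (forall w, differentiable A w) -> C2 f -> C2 (fun w => f (A w)).
Proof.
move=> AL dA [cf df]; split=> [|v]; first exact: (C1_affine AL dA cf).
rewrite (_ : 'D_v _ = fun w => 'D_(L v) f (A w)); first exact: (C1_affine AL dA (df _)).
by apply/funext => w; exact: derive_affine.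
Qed.

Lemma schwarz V (f : V -> R) v w p : C2 f -> 'D_v ('D_w f) p = 'D_w ('D_v f) p.
Proof.
move=> [c0 c0']; have cv := c0' v; have cw := c0' w.
have line q u (s a : R) : (a + s) *: u + q = a *: u + (s *: u + q) :> V.
  by rewrite scalerDl addrA.
have cline (U : topologicalType) (s : U -> R) (q : U -> V) u : continuous s -> continuous q ->
    continuous (fun x => s x *: u + q x).
  by move=> cs cq x; apply: cvgD; [apply: cvgZl; exact: cs|exact: cq].
(* [f (q + b v) - f q] is [b] times the mean of ['D_v f] over the segment: differentiate
   this along [w], divide by [b] and let [b] tend to 0. *)
pose g b := int01 (fun r : R => 'D_w ('D_v f) ((r * b) *: v + p)).
have sl q b : f (b *: v + q) - f q = b * int01 (fun r => 'D_v f ((r * b) *: v + q)).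
  have cf : continuous (fun s : R => 'D_v f (s *: v + q)).
    apply: (@continuous_compT _ _ _ (fun s : R => s *: v + q) ('D_v f)); last exact: C1_continuousD.
    by apply: (cline) => x; [exact: cvg_id|exact: cst_continuous].
  have df x : is_derive x (1 : R) (fun s => f (s *: v + q)) ('D_v f (x *: v + q)).
    apply: (is_derive_curve (c := fun s : R => s *: v + q)); last exact: C1_derivable.
    exact: line.
  have := @FTC_slope R (fun s => f (s *: v + q)) (fun s => 'D_v f (s *: v + q)) 0 b cf df.
  rewrite addr0 scale0r add0r => ->.
  by congr (_ * int01 _); apply/funext => r; rewrite addr0.
have d1 (k : V -> R) u q : C1 k -> is_derive (0:R) (1:R) (fun s => k (s *: u + q)) ('D_u k q).
  move=> ck; have := @is_derive_curve R V k (fun s : R => s *: u + q) u 0 (line q u 0).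
  by rewrite scale0r add0r; apply; exact: C1_derivable.
have crbw (b : R) : continuous (fun q : R * R => (q.2 * b) *: v + (q.1 *: w + p)).
  apply: (cline) => [q|]; first by apply: cvgM; [exact: cvg_snd|exact: cst_continuous].
  by apply: (cline) => q; [exact: cvg_fst|exact: cst_continuous].
have gE b : 'D_w f (b *: v + p) - 'D_w f p = b * g b.
  have d2 : is_derive (0:R) (1:R)
      (fun s => int01 (fun r => 'D_v f ((r * b) *: v + (s *: w + p)))) (g b).
    have -> : g b = int01 (fun r => 'D_w ('D_v f) ((r * b) *: v + (0 *: w + p))).
      by rewrite scale0r add0r.
    apply: (is_derive_param (K := fun q : R * R => 'D_v f ((q.2 * b) *: v + (q.1 *: w + p)))
      (K' := fun q : R * R => 'D_w ('D_v f) ((q.2 * b) *: v + (q.1 *: w + p))) param_linear_int01).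
    + exact: (@continuous_compT _ _ _ _ ('D_v f) (crbw b) (C1_continuous cv)).
    + exact: (@continuous_compT _ _ _ _ ('D_w ('D_v f)) (crbw b) (C1_continuousD cv)).
    + move=> r s.
      apply: (@is_derive_curve R V ('D_v f) (fun s : R => (r * b) *: v + (s *: w + p)) w s).
        by move=> c; rewrite line addrCA.
      apply: (@C1_derivable V (derive f ^~ v) _ w cv).
  have d3 : is_derive (0:R) (1:R) (fun s => f (s *: w + (b *: v + p)) - f (s *: w + p))
      ('D_w f (b *: v + p) - 'D_w f p) by exact: (@is_deriveB _ _ _ (fun s : R => f (s *: w + (b *: v + p))) (fun s : R => f (s *: w + p)) _ _ _ _ (d1 _ _ _ c0) (d1 _ _ _ c0)).
  have d4 := is_deriveZ b d2.
  have -> : b * g b = b *: g b by [].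
  rewrite -[LHS](derive_val (is_derive := d3)); rewrite -[RHS](derive_val (is_derive := d4)).
  by under [in LHS]eq_fun do rewrite addrCA sl.
have g0 : g 0 = 'D_w ('D_v f) p.
  rewrite /g; under eq_fun do rewrite mulr0 scale0r add0r.
  exact: int01_cst.
have cg : {for 0, continuous g}.
  apply: (@int01_param R R (fun q : R * R => 'D_w ('D_v f) ((q.2 * q.1) *: v + p))).
  apply: (@continuous_compT _ _ _ _ ('D_w ('D_v f)) _ (C1_continuousD cv)).
  apply: (cline) => q; last exact: cst_continuous.
  by apply: cvgM; [exact: cvg_snd|exact: cvg_fst].
have d5 : is_derive (0:R) (1:R) (fun b => 'D_w f (b *: v + p)) (g 0).
  apply: is_derive_slope cg _ => a.
  by rewrite addr0 scale0r add0r gE.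
have [_ d6] := d1 _ v p cw; have [_ d7] := d5.
exact: (etrans (esym d6) (etrans d7 g0)).
Qed.
End C1.

Lemma derive_translate (R : realType) (V : normedModType R) (f : V -> R) u v x :
  (forall x, f (x + u) = f x) -> 'D_v f (x + u) = 'D_v f x.
Proof. by move=> fu; rewrite /derive; under eq_fun do rewrite /= addrA !fu. Qed.

Lemma is_diff_fst (R : realType) (V W : normedModType R) (p : V * W) : is_diff p fst fst.
Proof.
have lfst : linear (fst : V * W -> V) by [].
pose s : {linear _ -> _} := HB.pack (fst : V * W -> V) (GRing.isLinear.Build _ _ _ _ _ lfst).
have cs : continuous s by move=> q; exact: cvg_fst.
by apply: DiffDef; [exact: (@linear_differentiable _ _ _ s)|exact: (@diff_lin _ _ _ s)].
Qed.

Lemma is_diff_snd (R : realType) (V W : normedModType R) (p : V * W) : is_diff p snd snd.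
Proof.
have lsnd : linear (snd : V * W -> W) by [].
pose s : {linear _ -> _} := HB.pack (snd : V * W -> W) (GRing.isLinear.Build _ _ _ _ _ lsnd).
have cs : continuous s by move=> q; exact: cvg_snd.
by apply: DiffDef; [exact: (@linear_differentiable _ _ _ s)|exact: (@diff_lin _ _ _ s)].
Qed.

Lemma C2_id (R : realType) : C2 (id : R -> R).
Proof.
have D v : 'D_v (id : R -> R) = fun _ => v by apply/funext => x; exact: derive_id.
split=> [|v]; last by rewrite D; exact: C1_cst.
split=> [x|v]; first exact: ex_diff.
by rewrite D; exact: cst_continuous.
Qed.

Lemma C2_comp_fst (R : realType) (V W : normedModType R) (f : V -> R) :
  C2 f -> C2 (fun p : V * W => f p.1).
Proof.
apply: (C2_affine (A := fun p : V * W => p.1) (L := fun p : V * W => p.1)) => // p.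
by have [] := is_diff_fst p.
Qed.

Lemma C2_comp_snd (R : realType) (V W : normedModType R) (f : W -> R) :
  C2 f -> C2 (fun p : V * W => f p.2).
Proof.
apply: (C2_affine (A := fun p : V * W => p.2) (L := fun p : V * W => p.2)) => // p.
by have [] := is_diff_snd p.
Qed.

(** * Rate of change of the flux through a moving graph *)

Section transport.
Context {R : realType} {n : nat}.
Implicit Types (X : 'I_n -> 'rV[R]_n * R -> R) (Xy g : 'rV[R]_n * R -> R).

Lemma C1_slice (g : R * 'rV[R]_n -> R) s : C1 g -> C1 (fun x => g (s, x)).
Proof.
move=> cg; apply: (C1_affine (A := fun x => (s, x)) (L := fun x => (0, x)) _ _ cg) => [h w v|w].
  by congr (_, _); rewrite /= scaler0 add0r.
by apply: differentiable_pair; [exact: differentiable_cst|exact: ex_diff].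
Qed.

Lemma derive_slice (g : R * 'rV[R]_n -> R) s x v :
  'D_v (fun x => g (s, x)) x = 'D_(0, v) g (s, x).
Proof.
apply: (@derive_affine _ _ _ (fun x => (s, x)) (fun x => (0, x))) => h w u.
by congr (_, _); rewrite /= scaler0 add0r.
Qed.

Lemma tint_dx_periodic (g : R * 'rV[R]_n -> R) i s : C1 g ->
  (forall s, ww_periodic (fun x => g (s, x))) ->
  ww_tint (fun x => 'D_(0, ww_ei i) g (s, x)) = 0.
Proof.
move=> cg pg; have cs := C1_slice s cg.
under eq_fun do rewrite -derive_slice.
apply: tint_derive_periodic; last by move=> x; exact: pg.
- exact: C1_continuous.
- by move=> x; exact: C1_derivable.
- exact: C1_continuousD.
Qed.

Lemma is_derive_tint (g : R * 'rV[R]_n -> R) s : C1 g ->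
  is_derive s (1 : R) (fun s => ww_tint (fun x => g (s, x)))
    (ww_tint (fun x => 'D_(1, 0) g (s, x))).
Proof.
move=> cg.
apply: (is_derive_param (K := g) (K' := 'D_(1, 0) g) (param_linear_tint n)).
- exact: C1_continuous.
- exact: C1_continuousD.
- move=> x r; apply: (@is_derive_curve _ _ g (fun s : R => (s, x)) (1, 0) r).
    by move=> a; congr (_, _); rewrite /= ?scaler0 ?add0r// [a *: 1]mulr1.
  exact: C1_derivable.
Qed.

Definition div X Xy p : R := \sum_i 'D_(ww_ei i, 0) (X i) p + 'D_(0, 1) Xy p.

Definition periodicx g := forall i x y, g (x + ww_ei i, y) = g (x, y).

(** The two integrands differ by the divergence on the torus of the field [Z i], the horizontal
    component on the graph times the vertical speed. Its integral is zero by periodicity, and the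
    mixed derivatives of [l] cancel by [schwarz]. *)
Lemma is_derive_flux X Xy (l : R * 'rV[R]_n -> R) s :
  (forall i, C1 (X i)) -> C1 Xy -> C2 l ->
  (forall i, periodicx (X i)) -> (forall s, ww_periodic (fun x => l (s, x))) ->
  is_derive s (1 : R)
    (fun s => ww_tint (fun x => Xy (x, l (s, x)) -
       \sum_i 'D_(0, ww_ei i) l (s, x) * X i (x, l (s, x))))
    (ww_tint (fun x => 'D_(1, 0) l (s, x) * div X Xy (x, l (s, x)))).
Proof.
move=> cX cXy cl pX pl; have cl1 := C2_C1 cl.
pose G g (p : R * 'rV[R]_n) := g (p.2, l p).
have cG g : C1 g -> C1 (G g) by move=> cg; apply: C1_graph => //; exact: is_diff_snd.
have DG g v p : C1 g -> 'D_v (G g) p = 'D_(v.2, 0) g (p.2, l p) + 'D_v l p * 'D_(0, 1) g (p.2, l p).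
  by move=> cg; apply: derive_graph => //; exact: is_diff_snd.
have cS : C1 (fun p => \sum_i 'D_(0, ww_ei i) l p * G (X i) p).
  by apply: C1_sum => i; apply: C1M; [exact: C2_D|exact: cG].
pose K p := G Xy p - \sum_i 'D_(0, ww_ei i) l p * G (X i) p.
have cK : C1 K by apply: C1B => //; exact: cG.
suff -> : ww_tint (fun x => 'D_(1, 0) l (s, x) * div X Xy (x, l (s, x))) =
    ww_tint (fun x => 'D_(1, 0) K (s, x)) by exact: (is_derive_tint s cK).
pose Z i p := 'D_(1, 0) l p * G (X i) p.
have cZ i : C1 (Z i) by apply: C1M; [exact: C2_D|exact: cG].
have -> : (fun x => 'D_(1, 0) l (s, x) * div X Xy (x, l (s, x))) =
    (fun x => 'D_(1, 0) K (s, x) + \sum_i 'D_(0, ww_ei i) (Z i) (s, x)).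
  apply/funext => x; rewrite (C1_DB _ _ (cG _ cXy) cS) C1_Dsum; last first.
    by move=> i; apply: C1M; [exact: C2_D|exact: cG].
  rewrite (DG _ _ _ cXy) /= -addrA -sumrN -big_split /= /div mulrDr addrC mulr_sumr.
  rewrite (derive0 Xy) add0r.
  congr (_ + _); apply: eq_bigr => i _.
  rewrite (C1_DM _ _ (C2_D _ cl) (cG _ (cX i))) (C1_DM _ _ (C2_D _ cl) (cG _ (cX i))).
  rewrite !(DG _ _ _ (cX i)) /= (schwarz _ _ _ cl).
  rewrite (derive0 (X i)) add0r.
  rewrite /G /=; ring.
have cslice (g : R * 'rV[R]_n -> R) : continuous g -> continuous (fun x => g (s, x)).
  by move=> cg; apply: continuous_compT cg; exact: continuous_pair_cstl.
rewrite tintD; first last.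
- by apply: continuous_sum_fun => i; exact: (cslice _ (C1_continuousD (cZ i))).
- exact: (cslice _ (C1_continuousD cK)).
rewrite tint_sum; last by move=> i; exact: (cslice _ (C1_continuousD (cZ i))).
rewrite big1 ?addr0// => i _; apply: tint_dx_periodic => // r j x.
rewrite /Z /G /=; congr (_ * _).
  have pl' p : l (p + (0, ww_ei j)) = l p.
    by case: p => a b; rewrite -[RHS](pl a j b); congr (l (_, _)); rewrite /= addr0.
  rewrite -[RHS](derive_translate _ _ pl'); congr (derive l _ _).
  by congr (_, _); rewrite /= addr0.
by rewrite pX pl.
Qed.
End transport.

(** * Decay of the Dirichlet energy at great depth *)

Section flux.
Context {R : realType}.

(** With second derivative at least [eps] towards minus infinity, the slope drops below -1, and from
    there [E] grows at least linearly as [s] decreases. *)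
Lemma convex_unbounded (E E' G : R -> R) (y1 eps M : R) : 0 < eps ->
  (forall s : R, is_derive s (1:R) E (E' s)) ->
  (forall s : R, is_derive s (1:R) E' (G s)) ->
  (forall s, s < y1 -> eps <= G s) -> (forall s, s < y1 -> E s <= M) -> False.
Proof.
move=> e0 dE dE' Ge EM.
have cont (F F' : R -> R) : (forall s : R, is_derive s (1:R) F (F' s)) -> continuous F.
  by move=> dF x; apply: differentiable_continuous; apply/derivable1_diffP; have [] := dF x.
(* Between [b] and [a] the slope changes by at least [eps] times [a - b], that is by [|E' a| + 1],
   so it is at most -1 below [b]. *)
pose a := y1 - 1; pose b := a - (`|E' a| + 1) / eps.
have ba : b < a by rewrite ltrBlDr ltrDl divr_gt0// ltr_wpDl.
have E'b s : s <= b -> E' s <= -1.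
  move=> sb; have [|c] := @MVT _ E' G s a (le_lt_trans sb ba) (fun x _ => dE' x).
    exact/continuous_subspaceT/(cont _ _ dE').
  rewrite in_itv /= => /andP[sc ca] Ec.
  have Gc : eps <= G c by apply: Ge; rewrite (lt_trans ca)// ltrBlDr ltrDl.
  have : (`|E' a| + 1) <= eps * (a - s).
    by rewrite -ler_pdivrMl// mulrC lerBrDr -lerBrDl; rewrite /b in sb; lra.
  have : eps * (a - s) <= G c * (a - s) by rewrite ler_wpM2r// subr_ge0 ltW// (lt_trans sc).
  have := ler_norm (E' a); lra.
(* With slope at most -1 on the left of [b], going down this far lifts [E] above
   [E b + |E b| + |M|], hence above [M]. *)
pose s := b - (`|M| + `|E b| + 1).
have sb : s < b by rewrite ltrBlDr ltrDl; have := normr_ge0 M; have := normr_ge0 (E b); lra.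
have [|c] := @MVT _ E E' s b sb (fun x _ => dE x).
  exact/continuous_subspaceT/(cont _ _ dE).
rewrite in_itv /= => /andP[sc cb] Ec.
have E'c := E'b c (ltW cb).
have : E' c * (b - s) <= -1 * (b - s) by rewrite ler_wpM2r// subr_ge0 ltW.
have : E s <= M by apply: EM; rewrite (lt_trans sb)// (lt_trans ba)// ltrBlDr ltrDl.
have := ler_norm M; have := ler_norm (- E b); rewrite normrN.
rewrite -Ec /s; lra.
Qed.

Variable n : nat.
Implicit Types (X : 'I_n -> 'rV[R]_n * R -> R) (Xy f g : 'rV[R]_n * R -> R).

(** No boundary value is prescribed, so the notion passes to vertical translates of an extension.
    The conditions are restricted to the cube because the comparison of graphs at different times
    comes from compactness and is obtained only there. *)
Definition harm (h : 'rV[R]_n -> R) f : Prop :=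
  [/\ C2 f, periodicx f,
      (forall x y, cube x -> y < h x -> ww_lap_xy f (x, y) = 0)
    & exists M, forall x y, cube x -> y < h x -> `|f (x, y)| <= M].

Definition gradsq f p : R := \sum_i 'D_(ww_ei i, 0) f p ^+ 2 + 'D_(0, 1) f p ^+ 2.

(** The height comes first, so that it acts as the parameter in [is_derive_tint] and
    [tint_dx_periodic]. *)
Definition swapf f (p : R * 'rV[R]_n) : R := f (p.2, p.1).

Lemma differentiable_swap (p : R * 'rV[R]_n) :
  differentiable (fun p : R * 'rV[R]_n => (p.2, p.1)) p.
Proof.
by apply: differentiable_pair; [have [] := is_diff_snd p|have [] := is_diff_fst p].
Qed.

Lemma C2_swap f : C2 f -> C2 (swapf f).
Proof.
move=> cf; apply: (C2_affine (A := fun p : R * 'rV[R]_n => (p.2, p.1))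
  (L := fun p : R * 'rV[R]_n => (p.2, p.1)) _ _ cf) => // p.
exact: differentiable_swap.
Qed.

Lemma C1_swap f : C1 f -> C1 (swapf f).
Proof.
move=> cf; apply: (C1_affine (A := fun p : R * 'rV[R]_n => (p.2, p.1))
  (L := fun p : R * 'rV[R]_n => (p.2, p.1)) _ _ cf) => // p.
exact: differentiable_swap.
Qed.

Lemma derive_swap f (v p : R * 'rV[R]_n) :
  'D_v (swapf f) p = swapf ('D_(v.2, v.1) f) p.
Proof.
exact: (@derive_affine _ _ _ (fun p : R * 'rV[R]_n => (p.2, p.1))
  (fun p : R * 'rV[R]_n => (p.2, p.1))).
Qed.

Lemma C1_gradsq f : C2 f -> C1 (gradsq f).
Proof.
move=> cf; rewrite /gradsq.
have c1 v : C1 (fun p => 'D_v f p ^+ 2).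
  by under eq_fun do rewrite expr2; apply: C1M; exact: C2_D.
by apply: C1D => //; apply: C1_sum.
Qed.

Lemma continuous_slicey (g : 'rV[R]_n * R -> R) y : continuous g -> continuous (fun x => g (x, y)).
Proof.
move=> cg; apply: continuous_compT cg.
by apply: continuous_pair => x; [exact: cvg_id|exact: cst_continuous].
Qed.

Lemma gradsq_ge0 f p : 0 <= gradsq f p.
Proof. by apply: addr_ge0; [apply: sumr_ge0 => i _|]; exact: sqr_ge0. Qed.

Lemma energy (h : 'rV[R]_n -> R) C f : harm h f -> (forall x, cube x -> - C <= h x) ->
  exists (E E' G : R -> R) (M : R),
  [/\ (forall s : R, is_derive s (1:R) E (E' s)),
      (forall s : R, is_derive s (1:R) E' (G s)),
      (forall s, s < - C -> G s = 2 * ww_tint (fun x => gradsq f (x, s)))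
    & (forall s, s < - C -> E s <= M)].
Proof.
move=> [cf pf lf [M fM]] hC.
have c2 := C2_swap cf; have c1 := C2_C1 c2.
pose u := 'D_(1, 0) (swapf f); have cu : C1 u by exact: C2_D.
pose g p := swapf f p * swapf f p.
have cg : C1 g by exact: C1M.
have dg p : 'D_(1, 0) g p = 2 * (swapf f p * u p) by rewrite (C1_DM _ _ c1 c1) /u; ring.
pose k p := 2 * (swapf f p * u p).
have cfu : C1 (fun p => swapf f p * u p) by exact: C1M.
have ck : C1 k by exact: (C1M (C1_cst _ 2) cfu).
have dk p : 'D_(1, 0) k p = 2 * (u p * u p + swapf f p * 'D_(1, 0) u p).
  rewrite (C1_DM _ _ (C1_cst _ 2) cfu) derive_cst mul0r add0r.
  by rewrite (C1_DM _ _ c1 cu).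
exists (fun s => ww_tint (fun x => g (s, x))), (fun s => ww_tint (fun x => k (s, x))),
  (fun s => ww_tint (fun x => 'D_(1, 0) k (s, x))), (M ^+ 2).
split.
- move=> s; have := is_derive_tint s cg; under [in X in is_derive _ _ _ X -> _]eq_fun do rewrite dg.
  exact.
- by move=> s; exact: is_derive_tint.
- move=> s sC.
  (* Integration by parts in [x]: the derivatives of f f_{x_i} integrate to zero, which turns f f_yy
     = - f Delta_x f into the squared horizontal gradient. *)
  pose w i p := swapf f p * swapf ('D_(ww_ei i, 0) f) p.
  have cw i : C1 (w i) by exact: (C1M c1 (C1_swap (C2_D _ cf))).
  have dw i p : 'D_(0, ww_ei i) (w i) p = swapf ('D_(ww_ei i, 0) f) p ^+ 2 +
      swapf f p * swapf ('D_(ww_ei i, 0) ('D_(ww_ei i, 0) f)) p.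
    rewrite (C1_DM _ _ c1 (C1_swap (C2_D _ cf))) !derive_swap /=.
    by rewrite expr2.
  have pw i : ww_tint (fun x => 'D_(0, ww_ei i) (w i) (s, x)) = 0.
    apply: (tint_dx_periodic _ _ (cw i)) => r j x; rewrite /w /swapf /= pf; congr (_ * _).
    have pf' p : f (p + (ww_ei j, 0)) = f p.
      by case: p => a b; rewrite -[RHS](pf j a b); congr (f (_, _)); rewrite /= addr0.
    rewrite -[RHS](@derive_translate _ _ f _ (ww_ei i, 0) (x, r) pf').
    rewrite (_ : (x, r) + (ww_ei j, 0) = (x + ww_ei j, r))//.
    by congr (_, _); rewrite /= addr0.
  have csl (q : R * 'rV[R]_n -> R) : continuous q -> continuous (fun x => q (s, x)).
    by move=> cq; apply: continuous_compT cq; exact: continuous_pair_cstl.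
  have cwi i : continuous (fun x => 'D_(0, ww_ei i) (w i) (s, x)).
    exact: (csl _ (C1_continuousD (cw i))).
  have cW : continuous (fun x => \sum_i 'D_(0, ww_ei i) (w i) (s, x)).
    exact: continuous_sum_fun.
  have ckk : continuous (fun x => 'D_(1, 0) k (s, x)) by exact: (csl _ (C1_continuousD ck)).
  have cgr : continuous (fun x => gradsq f (x, s)).
    exact: (@continuous_slicey (gradsq f) s (C1_continuous (C1_gradsq cf))).
  have W0 : ww_tint (fun x => \sum_i 'D_(0, ww_ei i) (w i) (s, x)) = 0.
    by rewrite tint_sum// big1.
  rewrite -[LHS]addr0 -(mulr0 2) -W0 -!tintZ// -tintD//; last first.
    by apply: continuousM_fun => //; exact: cst_continuous.
  apply: eq_tint_cube.
  + by apply: continuousD_fun => //; apply: continuousM_fun => //; exact: cst_continuous.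
  + by apply: continuousM_fun => //; exact: cst_continuous.
  + move=> x cx; rewrite dk /gradsq /u.
    under eq_bigr do rewrite dw.
    rewrite big_split /= -mulr_sumr derive_swap.
    have -> : 'D_(1, 0) (fun p => 'D_(1, 0) (swapf f) p) (s, x) = ww_dy (ww_dy f) (x, s).
      have -> : (fun p => 'D_(1, 0) (swapf f) p) = swapf ('D_(0, 1) f).
        by apply/funext => p; rewrite derive_swap.
      by rewrite derive_swap.
    rewrite /swapf /=.
    have /eqP := lf x s cx (lt_le_trans sC (hC x cx)).
    rewrite /ww_lap_xy addrC addr_eq0 => /eqP fyy.
    rewrite fyy.
    by rewrite expr2; set S := \sum_i _; ring.
- move=> s sC; rewrite -[M ^+ 2](tint_cst n); apply: tint_le.
  + exact: (C1_continuous (C1_slice s cg)).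
  + exact: cst_continuous.
  + move=> x cx; rewrite /g /swapf /= -expr2 -real_normK ?num_real//.
    by rewrite ler_pXn2r ?nnegrE ?(le_trans _ (fM x s cx _))// (lt_le_trans sC)// hC.
Qed.
End flux.

(** * Vanishing of the flux through the graph *)

Section flux_vanish.
Context {R : realType} {n : nat}.
Implicit Types (X : 'I_n -> 'rV[R]_n * R -> R) (Xy f g : 'rV[R]_n * R -> R).

(** Both functions are treated together because their energies must be small at the same height.
    Otherwise the sum of the two convex integrals would contradict its bound. *)
Lemma gradsq_decay (h : 'rV[R]_n -> R) C f1 f2 (eps y1 : R) : harm h f1 -> harm h f2 ->
  (forall x, cube x -> - C <= h x) -> 0 < eps ->
  exists2 y, y < y1 & ww_tint (fun x => gradsq f1 (x, y) + gradsq f2 (x, y)) < eps.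
Proof.
move=> h1 h2 hC e0.
have [E1 [E1' [G1 [M1 [dE1 dE1' GE1 EM1]]]]] := energy h1 hC.
have [E2 [E2' [G2 [M2 [dE2 dE2' GE2 EM2]]]]] := energy h2 hC.
have cgr f y : harm h f -> continuous (fun x => gradsq f (x, y)).
  by case=> cf _ _ _; exact: (@continuous_slicey _ _ (gradsq f) y (C1_continuous (C1_gradsq cf))).
apply: contrapT => nex.
pose y0 := Num.min y1 (- C).
apply: (@convex_unbounded R (fun s => E1 s + E2 s) (fun s => E1' s + E2' s)
  (fun s => G1 s + G2 s) y0 eps (M1 + M2) e0).
- move=> s; rewrite lt_min => /andP[sy sC]; rewrite GE1// GE2// -mulrDr -tintD; [|exact: cgr..].
  rewrite leNgt; apply/negP => lt; apply: nex; exists s => //.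
  apply: le_lt_trans lt; rewrite ler_peMl ?ler1n//.
  rewrite -(tint_cst n 0); apply: tint_le; first exact: cst_continuous.
    by apply: continuousD_fun; exact: cgr.
  by move=> x _; rewrite addr_ge0 ?gradsq_ge0.
- by move=> s; rewrite lt_min => /andP[sy sC]; rewrite lerD ?EM1 ?EM2.
Qed.

Lemma cube_bounded (h : 'rV[R]_n -> R) : continuous h ->
  exists2 C, 0 < C & forall x, cube x -> `|h x| <= C.
Proof.
move=> ch.
have cn : {within @cube R n, continuous (fun x => `|h x|)}.
  by apply: continuous_subspaceT; exact: (continuous_compT ch (@norm_continuous R R)).
have [|c _ hc] := @compact_EVT_max _ R (fun x => `|h x|) (@cube R n) _ (@compact_cube R n) cn.
  by exists 0; exact: cube0.
exists (`|h c| + 1); first by rewrite ltr_wpDl.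
by move=> x cx; rewrite (le_trans (hc x _)) ?inE// lerDl.
Qed.

(* [Xy] is the vertical component of the field; the normal is not normalised. *)
Definition normal_flux (h : 'rV[R]_n -> R) X Xy x : R :=
  Xy (x, h x) - \sum_i 'D_(ww_ei i) h x * X i (x, h x).

(** The bound allows an arbitrary [eta] because the fields contain terms linear in a gradient, which
    the quadratic energy density alone does not dominate. *)
Lemma flux_vanish (h : 'rV[R]_n -> R) X Xy f1 f2 :
  C2 h -> ww_periodic h ->
  (forall i, C1 (X i)) -> C1 Xy -> (forall i, periodicx (X i)) ->
  (forall x y, cube x -> y < h x -> div X Xy (x, y) = 0) ->
  harm h f1 -> harm h f2 ->
  (forall eta, 0 < eta -> exists K, forall x y, cube x -> y < h x ->
    `|Xy (x, y)| <= eta + K * (gradsq f1 (x, y) + gradsq f2 (x, y))) ->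
  ww_tint (normal_flux h X Xy) = 0.
Proof.
move=> ch ph cX cXy pX dX h1 h2 bX.
have [C C0 hC] := cube_bounded (C1_continuous (C2_C1 ch)).
have flat N : C < N -> ww_tint (normal_flux h X Xy) = ww_tint (fun x => Xy (x, - N)).
  move=> CN.
  (* Straight-line deformation from the graph of [h] at parameter 0 to the level [- N] at parameter
     1. As [N] exceeds the bound [C] of [h], it moves strictly downwards. *)
  pose l (p : R * 'rV[R]_n) := h p.2 + -1 * (p.1 * (h p.2 + N)).
  have ch2 : C2 (fun p : R * 'rV[R]_n => h p.2) by exact: (C2_comp_snd R ch).
  have cl : C2 l.
    have cfst : C2 (fun p : R * 'rV[R]_n => p.1) by exact: (C2_comp_fst _ (C2_id R)).
    exact: (C2D ch2 (C2M (C2_cst _ (-1)) (C2M cfst (C2D ch2 (C2_cst _ N))))).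
  have l0 : (fun x => l (0, x)) = h by apply/funext => x; rewrite /l /= mul0r mulr0 addr0.
  have l1 : (fun x => l (1, x)) = fun _ => - N.
    by apply/funext => x; rewrite /l /= mul1r mulN1r opprD addrA subrr add0r.
  have pl s : ww_periodic (fun x => l (s, x)) by move=> i x; rewrite /l /= ph.
  pose Q s := ww_tint (fun x => Xy (x, l (s, x)) -
       \sum_i 'D_(0, ww_ei i) l (s, x) * X i (x, l (s, x))).
  have dQ s := is_derive_flux s cX cXy cl pX pl.
  have -> : ww_tint (normal_flux h X Xy) = Q 0.
    congr ww_tint; apply/funext => x; rewrite /normal_flux -l0; congr (_ - _).
    by apply: eq_bigr => i _; rewrite derive_slice.
  have -> : ww_tint (fun x => Xy (x, - N)) = Q 1.
    congr ww_tint; apply/funext => x; rewrite -[l (1, x)]/((fun x => l (1, x)) x) l1.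
    rewrite big1 ?subr0// => i _.
    by rewrite -(derive_slice l 1 x) l1 derive_cst mul0r.
  have cQ : continuous Q.
    by move=> x; apply: differentiable_continuous; apply/derivable1_diffP; have [] := dQ x.
  (* For 0 < c < 1 the graph of l(c, .) lies strictly below that of h, where the divergence is 0. *)
  have [|c] := @MVT _ Q _ 0 1 ltr01 (fun s _ => dQ s); first exact: continuous_subspaceT.
  rewrite in_itv /= => /andP[c0 c1].
  rewrite (_ : ww_tint _ = 0) ?mul0r => [/eqP|]; first by rewrite subr_eq0 => /eqP ->.
  rewrite -[RHS](tint_cst n); apply: eq_tint_cube; last first.
  - move=> x cx; rewrite dX ?mulr0//.
    rewrite /l /= mulN1r ltrBlDr ltrDl mulr_gt0//.
    by have := hC x cx; rewrite ler_norml => /andP[]; lra.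
  - exact: cst_continuous.
  - have cG (g : 'rV[R]_n * R -> R) : continuous g -> continuous (fun x => g (x, l (c, x))).
      move=> cg; apply: continuous_compT cg; apply: continuous_pair => [x|]; first exact: cvg_id.
      exact: (C1_continuous (C1_slice c (C2_C1 cl))).
    apply: continuousM_fun; first exact: (continuous_compT (@continuous_pair_cstl _ _ c) (C1_continuousD (C2_C1 cl))).
    by apply: cG; apply: continuousD_fun; [apply: continuous_sum_fun => i|]; exact: C1_continuousD.
set F := ww_tint _; apply/eqP; rewrite -normr_le0; apply/ler_addgt0Pl => e e0; rewrite addr0.
have e2 : 0 < e / 2 by lra.
have [K bK] := bX _ e2.
(* [K] may be zero or negative, and the height [y] below is chosen for the threshold
   [e / 2 / K']. *)
pose K' := `|K| + 1; have K'0 : 0 < K' by rewrite ltr_wpDl.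
have hC' x : cube x -> - C <= h x by move=> /hC; rewrite ler_norml => /andP[].
have [y yC small] := gradsq_decay (- C) h1 h2 hC' (divr_gt0 e2 K'0).
have -> : F = ww_tint (fun x => Xy (x, y)).
  by rewrite -[y]opprK; apply: flat; rewrite ltrNr.
have cgr f : harm h f -> continuous (fun x => gradsq f (x, y)).
  by case=> cf _ _ _; exact: (@continuous_slicey _ _ (gradsq f) y (C1_continuous (C1_gradsq cf))).
have cg12 : continuous (fun x => gradsq f1 (x, y) + gradsq f2 (x, y)).
  by apply: continuousD_fun; exact: cgr.
have cKg : continuous (fun x => K' * (gradsq f1 (x, y) + gradsq f2 (x, y))).
  by apply: continuousM_fun => //; exact: cst_continuous.
apply: (@le_trans _ _ (ww_tint (fun x => e / 2 + K' * (gradsq f1 (x, y) + gradsq f2 (x, y))))).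
  apply: tint_abs_le.
  - exact: (@continuous_slicey _ _ Xy y (C1_continuous cXy)).
  - by apply: continuousD_fun => //; exact: cst_continuous.
  - move=> x cx; apply: (le_trans (bK x y cx _)); first by rewrite (lt_le_trans yC)// hC'.
    rewrite lerD2l; apply: ler_wpM2r; first by rewrite addr_ge0 ?gradsq_ge0.
    by apply: (le_trans (ler_norm K)); rewrite /K' lerDl.
rewrite tintD//; last exact: cst_continuous.
rewrite tint_cst tintZ//.
have : K' * ww_tint (fun x => gradsq f1 (x, y) + gradsq f2 (x, y)) <= K' * (e / 2 / K').
  by rewrite ler_wpM2l// ltW.
by rewrite mulrCA divff ?gt_eqF// mulr1; lra.
Qed.
End flux_vanish.

(** * Algebraic identities and Young-type bounds for the fields *)

Section algebra.
Context {R : realType}.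
Implicit Types a b c d e f g : R.

Lemma green_deriv_alg a b c d e f : a * b + c * d - (b * a + e * f) = c * d - e * f.
Proof. ring. Qed.

Lemma green_div_alg a b Sf yf Sg yg : Sf + yf = 0 -> Sg + yg = 0 :> R ->
  a * Sg - b * Sf + (a * yg - b * yf) = 0.
Proof.
move=> /eqP; rewrite addrC addr_eq0 => /eqP -> /eqP; rewrite addrC addr_eq0 => /eqP ->.
ring.
Qed.

Lemma noether_sum_alg (I : finType) (F fii gii fi gi fyi gyi : I -> R) fy gy :
  (forall i, F i = fii i * gy + fi i * gyi i + (gii i * fy + gi i * fyi i) - gii i) ->
  \sum_i F i = (\sum_i fii i) * gy + (\sum_i gii i) * fy - \sum_i gii i +
                \sum_i (fi i * gyi i + gi i * fyi i).
Proof.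
move=> FE; rewrite !mulr_suml -sumrN -!big_split /=; apply: eq_bigr => i _.
by rewrite FE; ring.
Qed.

Lemma green_sum_alg (I : finType) (F u v : I -> R) a b :
  (forall i, F i = a * u i - b * v i) -> \sum_i F i = a * (\sum_i u i) - b * \sum_i v i.
Proof. by move=> FE; rewrite !mulr_sumr -sumrB; apply: eq_bigr => i _. Qed.

Lemma noether_div_alg Sf Sg fyy gyy fy gy T : Sf + fyy = 0 -> Sg + gyy = 0 :> R ->
  Sf * gy + Sg * fy - Sg + T + (fyy * gy + fy * gyy - T - gyy) = 0.
Proof.
move=> /eqP; rewrite addrC addr_eq0 => /eqP -> /eqP; rewrite addrC addr_eq0 => /eqP ->.
ring.
Qed.

Lemma ler_norm_mul a b : `|a * b| <= a ^+ 2 + b ^+ 2.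
Proof.
rewrite normrM -[a ^+ 2]real_normK ?num_real// -[b ^+ 2]real_normK ?num_real//.
by have := sqr_ge0 (`|a| - `|b|); have := normr_ge0 a; have := normr_ge0 b; nra.
Qed.

Lemma young (eta M a : R) : 0 < eta -> M * `|a| <= eta + M ^+ 2 / eta * a ^+ 2.
Proof.
move=> e0; rewrite -[a ^+ 2]real_normK ?num_real//.
have : 0 <= (eta - M * `|a|) ^+ 2 / eta by rewrite divr_ge0 ?sqr_ge0// ltW.
rewrite (_ : _ / eta = eta + M ^+ 2 / eta * `|a| ^+ 2 - 2 * (M * `|a|)); last first.
  by field; rewrite gt_eqF.
have [Ma|/ltW Ma] := leP 0 (M * `|a|); first lra.
move=> _; apply: (le_trans Ma); apply: addr_ge0; first exact: ltW.
by apply: mulr_ge0; [rewrite divr_ge0 ?sqr_ge0// ltW|exact: sqr_ge0].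
Qed.

(** Each product is a bounded function times a gradient; Young's inequality is applied to both with
    half of [eta]. *)
Lemma green_bound_alg (eta M f g fy gy Gf Gg : R) : 0 < eta -> `|f| <= M -> `|g| <= M ->
  fy ^+ 2 <= Gf -> gy ^+ 2 <= Gg ->
  `|f * gy - g * fy| <= eta + M ^+ 2 / (eta / 2) * (Gf + Gg).
Proof.
move=> e0 fM gM fG gG; have e2 : 0 < eta / 2 by lra.
have yg := young M gy e2; have yf := young M fy e2.
apply: (le_trans (ler_normB _ _)); rewrite !normrM mulrDr.
have := ler_wpM2r (normr_ge0 gy) fM; have := ler_wpM2r (normr_ge0 fy) gM.
have K0 : 0 <= M ^+ 2 / (eta / 2) by rewrite divr_ge0 ?sqr_ge0// ltW.
have := ler_wpM2l K0 fG; have := ler_wpM2l K0 gG; lra.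
Qed.

(** The quadratic terms are dominated by the energy density directly; only the linear term [gy]
    consumes [eta]. *)
Lemma noether_bound_alg (I : finType) (eta fy gy : R) (u v : I -> R) : 0 < eta ->
  `|fy * gy - \sum_i u i * v i - gy| <=
  eta + (1 + 1 / eta) * (\sum_i u i ^+ 2 + fy ^+ 2 + (\sum_i v i ^+ 2 + gy ^+ 2)).
Proof.
move=> e0.
have S : `|\sum_i u i * v i| <= \sum_i u i ^+ 2 + \sum_i v i ^+ 2.
  rewrite -big_split /=; apply: (le_trans (ler_norm_sum _ _ _)).
  by apply: ler_sum => i _; exact: ler_norm_mul.
have := young 1 gy e0; rewrite mul1r expr1n.
have := ler_norm_mul fy gy.
have := ler_normB (fy * gy - \sum_i u i * v i) gy.
have := ler_normB (fy * gy) (\sum_i u i * v i).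
have A : 0 <= \sum_i u i ^+ 2 by apply: sumr_ge0 => i _; exact: sqr_ge0.
have B : 0 <= \sum_i v i ^+ 2 by apply: sumr_ge0 => i _; exact: sqr_ge0.
have C : 0 <= 1 / eta * (\sum_i u i ^+ 2 + fy ^+ 2 + \sum_i v i ^+ 2).
  by rewrite mulr_ge0 ?divr_ge0 ?addr_ge0 ?sqr_ge0// ltW.
have := sqr_ge0 fy; lra.
Qed.

End algebra.

(** * Three divergence-free fields built from harmonic functions *)

Section identities.
Context {R : realType} {n : nat}.
Implicit Types (f g : 'rV[R]_n * R -> R) (h : 'rV[R]_n -> R).
Local Notation Dx i f := ('D_(ww_ei i, 0) f).
Local Notation Dy f := ('D_(0, 1) f).

Lemma periodicx_derive f v : periodicx f -> periodicx ('D_v f).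
Proof.
move=> pf i x y.
have pf' p : f (p + (ww_ei i, 0)) = f p.
  by case: p => a b; rewrite -[RHS](pf i a b); congr (f (_, _)); rewrite /= addr0.
rewrite -[RHS](@derive_translate _ _ f _ v (x, y) pf').
rewrite (_ : (x, y) + (ww_ei i, 0) = (x + ww_ei i, y))//.
by congr (_, _); rewrite /= addr0.
Qed.

Lemma lapE f p : ww_lap_xy f p = \sum_i Dx i (Dx i f) p + Dy (Dy f) p.
Proof. by []. Qed.

Lemma gradsq_ge_dy f p : Dy f p ^+ 2 <= gradsq f p.
Proof. by rewrite /gradsq lerDr; apply: sumr_ge0 => i _; exact: sqr_ge0. Qed.

Lemma flux_harm h f : C2 h -> ww_periodic h -> harm h f ->
  ww_tint (normal_flux h (fun i => Dx i f) (Dy f)) = 0.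
Proof.
move=> ch ph hf; have [cf pf lf _] := hf.
apply: (flux_vanish ch ph _ (C2_D _ cf) _ _ hf hf).
- by move=> i; exact: (C2_D _ cf).
- by move=> i; exact: (periodicx_derive _ pf).
- by move=> x y cx yh; rewrite /div -lapE lf.
- move=> eta e0; exists (1 / eta) => x y _ _.
  have := young 1 (Dy f (x, y)) e0; rewrite mul1r expr1n => /le_trans; apply.
  rewrite lerD2l; apply: ler_wpM2l; first by rewrite divr_ge0// ltW.
  by rewrite (le_trans (gradsq_ge_dy f (x, y)))// lerDl gradsq_ge0.
Qed.

Lemma green h f g : C2 h -> ww_periodic h -> harm h f -> harm h g ->
  ww_tint (normal_flux h (fun i p => f p * Dx i g p - g p * Dx i f p)
    (fun p => f p * Dy g p - g p * Dy f p)) = 0.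
Proof.
move=> ch ph hf hg; have [cf pf lf [Mf bf]] := hf; have [cg pg lg [Mg bg]] := hg.
have c1 := C2_C1 cf; have c2 := C2_C1 cg.
have cfg v : C1 (fun p => f p * 'D_v g p) by exact: (C1M c1 (C2_D _ cg)).
have cgf v : C1 (fun p => g p * 'D_v f p) by exact: (C1M c2 (C2_D _ cf)).
have dd v p : 'D_v (fun p => f p * 'D_v g p - g p * 'D_v f p) p =
    f p * 'D_v ('D_v g) p - g p * 'D_v ('D_v f) p.
  rewrite (C1_DB _ _ (cfg v) (cgf v)) (C1_DM _ _ c1 (C2_D _ cg)) (C1_DM _ _ c2 (C2_D _ cf)).
  exact: green_deriv_alg.
apply: (flux_vanish ch ph _ (C1B (cfg _) (cgf _)) _ _ hf hg).
- by move=> i; exact: (C1B (cfg _) (cgf _)).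
- move=> i j x y; rewrite pf pg.
  by rewrite (periodicx_derive _ pf) (periodicx_derive _ pg).
- move=> x y cx yh; rewrite /div dd (green_sum_alg (fun i => dd _ (x, y))).
  exact: (green_div_alg _ _ (lf x y cx yh) (lg x y cx yh)).
- move=> eta e0; pose M := `|Mf| + `|Mg|; exists (M ^+ 2 / (eta / 2)) => x y cx yh.
  apply: (green_bound_alg e0 _ _ (gradsq_ge_dy f (x, y)) (gradsq_ge_dy g (x, y))).
    by rewrite (le_trans (bf _ _ cx yh))// (le_trans (ler_norm _))// lerDl.
  by rewrite (le_trans (bg _ _ cx yh))// (le_trans (ler_norm _))// lerDr.
Qed.

(* The stress-energy tensor of the pair (f, g) applied to the vertical translation
   field, minus grad g. *)
Lemma noether h f g : C2 h -> ww_periodic h -> harm h f -> harm h g ->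
  ww_tint (normal_flux h (fun i p => Dx i f p * Dy g p + Dx i g p * Dy f p - Dx i g p)
    (fun p => Dy f p * Dy g p - \sum_j Dx j f p * Dx j g p - Dy g p)) = 0.
Proof.
move=> ch ph hf hg; have [cf pf lf _] := hf; have [cg pg lg _] := hg.
have df v : C1 ('D_v f) by exact: C2_D.
have dg v : C1 ('D_v g) by exact: C2_D.
have cM u v : C1 (fun p => 'D_u f p * 'D_v g p) by exact: (C1M (df _) (dg _)).
have cM' u v : C1 (fun p => 'D_u g p * 'D_v f p) by exact: (C1M (dg _) (df _)).
have cS : C1 (fun p => \sum_j Dx j f p * Dx j g p) by exact: (C1_sum _ (fun j => cM _ _)).
apply: (flux_vanish ch ph _ (C1B (C1B (cM _ _) cS) (dg _)) _ _ hf hg).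
- by move=> i; exact: (C1B (C1D (cM _ _) (cM' _ _)) (dg _)).
- by move=> i j x y; rewrite !(periodicx_derive _ pf) !(periodicx_derive _ pg).
- move=> x y cx yh; rewrite /div.
  have -> : \sum_i Dx i (fun p => Dx i f p * Dy g p + Dx i g p * Dy f p - Dx i g p) (x, y) =
      (\sum_i Dx i (Dx i f) (x, y)) * Dy g (x, y) + (\sum_i Dx i (Dx i g) (x, y)) * Dy f (x, y)
      - (\sum_i Dx i (Dx i g) (x, y)) +
      \sum_i (Dx i f (x, y) * Dx i (Dy g) (x, y) + Dx i g (x, y) * Dx i (Dy f) (x, y)).
    apply: noether_sum_alg => i.
    rewrite (C1_DB _ _ (C1D (cM _ _) (cM' _ _)) (dg _)) (C1_DD _ _ (cM _ _) (cM' _ _)).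
    by rewrite (C1_DM _ _ (df _) (dg _)) (C1_DM _ _ (dg _) (df _)).
  have -> : Dy (fun p => Dy f p * Dy g p - \sum_j Dx j f p * Dx j g p - Dy g p) (x, y) =
      Dy (Dy f) (x, y) * Dy g (x, y) + Dy f (x, y) * Dy (Dy g) (x, y) -
      \sum_i (Dx i f (x, y) * Dx i (Dy g) (x, y) + Dx i g (x, y) * Dx i (Dy f) (x, y))
      - Dy (Dy g) (x, y).
    rewrite (C1_DB _ _ (C1B (cM _ _) cS) (dg _)) (C1_DB _ _ (cM _ _) cS).
    rewrite (C1_DM _ _ (df _) (dg _)) (C1_Dsum _ _ _ (fun j => cM _ _)).
    congr (_ - _ - _); apply: eq_bigr => i _.
    rewrite (C1_DM _ _ (df _) (dg _)) (schwarz _ _ _ cf).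
    by rewrite (schwarz _ _ _ cg) addrC [X in _ + X]mulrC.
  exact: (noether_div_alg _ _ _ (lf x y cx yh) (lg x y cx yh)).
- by move=> eta e0; exists (1 + 1 / eta) => x y _ _; exact: noether_bound_alg.
Qed.
End identities.

(** * One-sided limits and derivatives *)

Section one_sided.
Context {R : realType}.

Lemma continuous_left0 (F : R -> R) b : continuous F -> (forall y, y < b -> F y = 0) -> F b = 0.
Proof.
move=> cF F0.
have c1 : F y @[y --> b^'-] --> F b by apply: cvg_at_left_filter; exact: cF.
have c2 : F y @[y --> b^'-] --> (0:R).
  by apply: cvg_near_cst; near=> y; apply: F0; near: y; exact: nbhs_left_lt.
exact: (cvg_unique _ c1 c2).
Unshelve. all: by end_near.
Qed.

Lemma is_derive_right0 (D : R -> R) (t d e : R) : is_derive t (1:R) D d -> 0 < e ->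
  (forall s, t <= s <= t + e -> D s = 0) -> d = 0.
Proof.
move=> [dD <-] e0 D0.
have c1 : h^-1 *: (D (h *: 1 + t) - D t) @[h --> (0:R)^'+] --> 'D_1 D t.
  by apply: cvg_dnbhs_at_right; exact: dD.
have c2 : h^-1 *: (D (h *: 1 + t) - D t) @[h --> (0:R)^'+] --> (0:R).
  apply: cvg_near_cst; near=> h.
  have h0 : 0 < h by near: h; exact: nbhs_right_gt.
  have he : h < e by near: h; exact: nbhs_right_lt.
  by rewrite [h *: 1]mulr1 !D0 ?subrr ?scaler0//; apply/andP; split; lra.
exact: (cvg_unique _ c1 c2).
Unshelve. all: by end_near.
Qed.

Lemma is_derive_left0 (D : R -> R) (t d e : R) : is_derive t (1:R) D d -> 0 < e ->
  (forall s, t - e <= s <= t -> D s = 0) -> d = 0.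
Proof.
move=> [dD <-] e0 D0.
have c1 : h^-1 *: (D (h *: 1 + t) - D t) @[h --> (0:R)^'-] --> 'D_1 D t.
  by apply: cvg_dnbhs_at_left; exact: dD.
have c2 : h^-1 *: (D (h *: 1 + t) - D t) @[h --> (0:R)^'-] --> (0:R).
  apply: cvg_near_cst; near=> h.
  have h0 : h < 0 by near: h; exact: nbhs_left_lt.
  have he : - e < h by near: h; apply: nbhs_left_gt; rewrite oppr_lt0.
  by rewrite [h *: 1]mulr1 !D0 ?subrr ?scaler0//; apply/andP; split; lra.
exact: (cvg_unique _ c1 c2).
Unshelve. all: by end_near.
Qed.
End one_sided.

(** * The flux identities expressed on the graph *)

Section trace.
Context {R : realType} {n : nat}.
Implicit Types (f g : 'rV[R]_n * R -> R) (h : 'rV[R]_n -> R).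
Local Notation Dx i f := ('D_(ww_ei i, 0) f).
Local Notation Dy f := ('D_(0, 1) f).

(** [f] is C2 across the graph, so its Laplacian is continuous there and the value 0 passes to the
    boundary from below. *)
Lemma harm_lap0 h f x : harm h f -> cube x -> ww_lap_xy f (x, h x) = 0.
Proof.
move=> [cf _ lf _] cx.
apply: (@continuous_left0 _ (fun y => ww_lap_xy f (x, y)) (h x)); last by move=> y; exact: lf.
have cxy (g : 'rV[R]_n * R -> R) : continuous g -> continuous (fun y => g (x, y)).
  by move=> cg; exact: (continuous_compT (@continuous_pair_cstl _ _ x) cg).
apply: continuousD_fun; last exact: (cxy _ (C1_continuousD (C2_D _ cf))).
by apply: continuous_sum_fun => i; exact: (cxy _ (C1_continuousD (C2_D _ cf))).
Qed.

Lemma harm_of_ext h psi f : ww_harmonic_ext h psi f -> harm h f.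
Proof.
move=> [sf pf lf [M bf] _]; split.
- exact: smooth_C2.
- exact: pf.
- by move=> x y _; exact: lf.
- by exists M => x y _; exact: bf.
Qed.

Definition shifty (a : R) f (p : 'rV[R]_n * R) : R := f (p.1, p.2 - a).

Lemma derive_shifty a f v p : 'D_v (shifty a f) p = shifty a ('D_v f) p.
Proof.
apply: (@derive_affine _ _ _ (fun p : 'rV[R]_n * R => (p.1, p.2 - a)) id) => k w u.
by congr (_, _); rewrite /= addrA.
Qed.

Lemma harm_shifty h0 h a f : harm h0 f -> (forall x, cube x -> h x - a <= h0 x) ->
  harm h (shifty a f).
Proof.
move=> [cf pf lf [M bf]] hh; split.
- apply: (C2_affine (A := fun p : 'rV[R]_n * R => (p.1, p.2 - a)) (L := id) _ _ cf) => [k w u|p].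
    by congr (_, _); rewrite /= addrA.
  apply: differentiable_pair; first by have [] := is_diff_fst p.
  have [ds _] := is_diff_snd p.
  by apply: differentiableB => //; exact: differentiable_cst.
- by move=> i x y; exact: pf.
- move=> x y cx yh; rewrite -[RHS](lf x (y - a) cx); last first.
    by rewrite (lt_le_trans _ (hh x cx))// ltrD2r.
  have d2 v p : 'D_v ('D_v (shifty a f)) p = shifty a ('D_v ('D_v f)) p.
    have -> : 'D_v (shifty a f) = shifty a ('D_v f).
      by apply/funext => q; exact: derive_shifty.
    exact: derive_shifty.
  rewrite !lapE; apply: (f_equal2 +%R); last exact: (d2 (0, 1) (x, y)).
  by apply: eq_bigr => i _; exact: (d2 (ww_ei i, 0) (x, y)).
- exists M => x y cx yh; apply: bf => //.
  by rewrite (lt_le_trans _ (hh x cx))// ltrD2r.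
Qed.

Lemma derive_trace h f v x : C2 h -> C2 f ->
  'D_v (fun x => f (x, h x)) x = 'D_(v, 0) f (x, h x) + 'D_v h x * Dy f (x, h x).
Proof.
move=> ch cf.
exact: (@derive_graph R _ _ id h f v x (fun w => is_diff_id w) (C2_C1 ch) (C2_C1 cf)).
Qed.

Lemma continuous_normal_flux h X Xy : C2 h -> (forall i, C1 (X i)) -> C1 Xy ->
  continuous (normal_flux h X Xy).
Proof.
move=> ch cX cXy.
have ct (g : 'rV[R]_n * R -> R) : C1 g -> continuous (fun x => g (x, h x)).
  move=> cg; exact: (C1_continuous (C1_graph (a := id) (fun w => is_diff_id w) (C2_C1 ch) cg)).
apply: continuousB_fun; first exact: ct.
apply: continuous_sum_fun => i; apply: continuousM_fun; last exact: ct.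
exact: (C1_continuousD (C2_C1 ch)).
Qed.

Lemma noether_trace_alg (I : finType) (u v w : I -> R) (fy gy ht : R) :
  (forall i, v i + u i * fy = u i) -> ht + (fy - \sum_i u i * v i) = 0 ->
  fy * gy - \sum_i v i * w i - gy - \sum_i u i * (v i * gy + w i * fy - w i) =
  -1 * ((1 + ht) * gy).
Proof.
move=> vE hE.
have -> : \sum_i v i * w i = (1 - fy) * \sum_i u i * w i.
  rewrite mulr_sumr; apply: eq_bigr => i _.
  have -> : v i = u i - u i * fy by have := vE i; lra.
  ring.
have -> : \sum_i u i * (v i * gy + w i * fy - w i) =
    gy * (\sum_i u i * v i) + (fy - 1) * \sum_i u i * w i.
  by rewrite !mulr_sumr -big_split /=; apply: eq_bigr => i _; ring.
have -> : \sum_i u i * v i = ht + fy by lra.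
ring.
Qed.

(** The field of [noether] is the stress-energy field of the pair (f - y, g). Since f - y vanishes
    on the graph, its gradient is [Dy f - 1] times the normal (-grad h, 1); the other two terms of
    the flux cancel, and the normal derivative is read from the equation. *)
Lemma noether_trace h f g ht : C2 h -> ww_periodic h -> harm h f -> harm h g ->
  (forall x, f (x, h x) = h x) -> (forall x, ht x + ww_DN h f x = 0) ->
  ww_tint (fun x => (1 + ht x) * Dy g (x, h x)) = 0.
Proof.
move=> ch ph hf hg fh hDN; have [cf _ _ _] := hf; have [cg _ _ _] := hg.
have N0 := noether ch ph hf hg.
have E : normal_flux h (fun i p => Dx i f p * Dy g p + Dx i g p * Dy f p - Dx i g p)
    (fun p => Dy f p * Dy g p - \sum_j Dx j f p * Dx j g p - Dy g p) =
    fun x => -1 * ((1 + ht x) * Dy g (x, h x)).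
  apply/funext => x; apply: noether_trace_alg; last exact: (hDN x).
  move=> i; rewrite -(derive_trace (ww_ei i) x ch cf).
  by congr (derive _ _ _); apply/funext => y; rewrite fh.
rewrite E in N0.
have htE : ht = fun x => - ww_DN h f x.
  by apply/funext => x; apply/eqP; rewrite -addr_eq0 hDN.
have ct (k : 'rV[R]_n * R -> R) : C1 k -> continuous (fun x => k (x, h x)).
  move=> ck; exact: (C1_continuous (C1_graph (a := id) (fun w => is_diff_id w) (C2_C1 ch) ck)).
have cht : continuous ht.
  rewrite htE; apply: continuousN_fun.
  exact: (@continuous_normal_flux h (fun i => Dx i f) (Dy f) ch (fun i => C2_D _ cf) (C2_D _ cf)).
move: N0; rewrite tintZ; first by rewrite mulN1r => /eqP; rewrite oppr_eq0 => /eqP.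
apply: continuousM_fun; last exact: (ct _ (C2_D _ cg)).
by apply: continuousD_fun => //; exact: cst_continuous.
Qed.

Lemma green_trace_alg (I : finType) (u v w u' w' : I -> R) (H f g fy gy gy' ht a l : R) :
  (forall i, u' i = u i) -> (forall i, w i = w' i) -> gy = gy' -> f = H -> l = H - a -> ht + (fy - \sum_i u i * v i) = 0 ->
  ht * g + (l * gy' - \sum_i u' i * (l * w' i)) =
  (f * gy - g * fy - \sum_i u i * (f * w i - g * v i)) + - a * (gy - \sum_i u i * w i).
Proof.
move=> uE wE <- -> -> hE.
have -> : \sum_i u' i * ((H - a) * w' i) = (H - a) * \sum_i u i * w i.
  by rewrite mulr_sumr; apply: eq_bigr => i _; rewrite uE wE; ring.
have -> : \sum_i u i * (H * w i - g * v i) = H * (\sum_i u i * w i) - g * \sum_i u i * v i.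
  by rewrite !mulr_sumr -sumrB; apply: eq_bigr => i _; ring.
have -> : \sum_i u i * v i = ht + fy by lra.
ring.
Qed.

(** Green's identity carries the weight [h] on the normal derivative of the shifted [g]. Replacing
    it by the height [h - a] of the lowered graph costs [a] times the flux of a gradient, which is
    zero. The gain is that y grad g is a fixed field, so the transport formula applies when the
    graph moves. *)
Lemma green_trace h h0 f g ht a : C2 h -> ww_periodic h -> harm h f -> harm h0 g ->
  (forall x, cube x -> h x - a <= h0 x) ->
  (forall x, f (x, h x) = h x) -> (forall x, ht x + ww_DN h f x = 0) ->
  ww_tint (fun x => ht x * g (x, h x - a) +
    normal_flux (fun x => h x - a) (fun i p => p.2 * Dx i g p) (fun p => p.2 * Dy g p) x) = 0.
Proof.
move=> ch ph hf hg0 hh fh hDN.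
have hg := harm_shifty hg0 hh; have [cf _ _ _] := hf; have [cg _ _ _] := hg.
have G0 := green ch ph hf hg; have F0 := flux_harm ch ph hg.
have cF : continuous (normal_flux h (fun i => Dx i (shifty a g)) (Dy (shifty a g))).
  exact: (@continuous_normal_flux h _ _ ch (fun i => C2_D _ cg) (C2_D _ cg)).
have fg v : C1 (fun p => f p * 'D_v (shifty a g) p - shifty a g p * 'D_v f p).
  exact: (C1B (C1M (C2_C1 cf) (C2_D _ cg)) (C1M (C2_C1 cg) (C2_D _ cf))).
have cG : continuous (normal_flux h
    (fun i p => f p * Dx i (shifty a g) p - shifty a g p * Dx i f p)
    (fun p => f p * Dy (shifty a g) p - shifty a g p * Dy f p)).
  exact: (@continuous_normal_flux h _ _ ch (fun i => fg _) (fg _)).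
transitivity (ww_tint (normal_flux h (fun i p => f p * Dx i (shifty a g) p - shifty a g p * Dx i f p)
    (fun p => f p * Dy (shifty a g) p - shifty a g p * Dy f p)) +
    - a * ww_tint (normal_flux h (fun i => Dx i (shifty a g)) (Dy (shifty a g)))); last first.
  by rewrite G0 F0 mulr0 addr0.
rewrite -tintZ// -tintD//; last by apply: continuousM_fun => //; exact: cst_continuous.
congr ww_tint; apply/funext => x.
have dh v : 'D_v (fun x => h x - a) x = 'D_v h x.
  by rewrite (C1_DB _ _ (C2_C1 ch) (C1_cst _ a)) derive_cst subr0.
apply: (@green_trace_alg _ (fun i => 'D_(ww_ei i) h x) (fun i => Dx i f (x, h x))
  (fun i => Dx i (shifty a g) (x, h x)) (fun i => 'D_(ww_ei i) (fun x => h x - a) x)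
  (fun i => Dx i g (x, h x - a)) (h x) (f (x, h x)) (g (x, h x - a)) (Dy f (x, h x))
  (Dy (shifty a g) (x, h x)) (Dy g (x, h x - a)) (ht x) a (h x - a)).
- by move=> i; exact: dh.
- by move=> i; exact: derive_shifty.
- exact: derive_shifty.
- exact: fh.
- by [].
- exact: (hDN x).
Qed.
End trace.

(** * Time derivative of Green's identity on the sinking graph *)

Section evolution.
Context {R : realType} {n : nat}.
Implicit Types (f g : 'rV[R]_n * R -> R) (h : R * 'rV[R]_n -> R).
Local Notation Dx i f := ('D_(ww_ei i, 0) f).
Local Notation Dy f := ('D_(0, 1) f).
Local Notation Dt h := ('D_(1, 0) h).

Lemma C2_slice h s : C2 h -> C2 (fun x => h (s, x)).
Proof.
move=> ch; apply: (C2_affine (A := fun x => (s, x)) (L := fun x => (0, x)) _ _ ch) => [k w v|w].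
  by congr (_, _); rewrite /= scaler0 add0r.
by apply: differentiable_pair; [exact: differentiable_cst|exact: ex_diff].
Qed.

(** The graph lowered at speed [c], equal to that of [h] at time [t]. The expression uses sums and
    products only, to match [C2D] and [C2M]. *)
Definition sink h (c t : R) (p : R * 'rV[R]_n) : R := h p + - c * (p.1 + - t).

Lemma C2_sink h c t : C2 h -> C2 (sink h c t).
Proof.
move=> ch; have cfst : C2 (fun p : R * 'rV[R]_n => p.1) by exact: (C2_comp_fst _ (C2_id R)).
exact: (C2D ch (C2M (C2_cst _ (- c)) (C2D cfst (C2_cst _ (- t))))).
Qed.

Lemma derive_sink h c t p : C2 h -> Dt (sink h c t) p = Dt h p - c.
Proof.
move=> ch; have cfst : C1 (fun p : R * 'rV[R]_n => p.1).
  by exact: (C2_C1 (C2_comp_fst _ (C2_id R))).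
have cfstB := C1D cfst (C1_cst _ (- t)).
rewrite (C1_DD _ _ (C2_C1 ch) (C1M (C1_cst _ (- c)) cfstB)); congr (_ + _).
rewrite (C1_DM _ _ (C1_cst _ (- c)) cfstB) derive_cst mul0r add0r.
rewrite (C1_DD _ _ cfst (C1_cst _ (- t))) derive_cst addr0.
have -> : Dt (fun p : R * 'rV[R]_n => p.1) p = 1; last by rewrite mulr1.
by rewrite (@derive_affine R _ _ (fun p : R * 'rV[R]_n => p.1) (fun p => p.1) id) ?derive_id.
Qed.

Lemma sink_div_alg (I : finType) (F u : I -> R) (G a w gy : R) :
  (forall i, F i = a * u i) -> G = gy + a * w -> \sum_i F i + G = a * (\sum_i u i + w) + gy.
Proof.
move=> FE ->; have -> : \sum_i F i = a * \sum_i u i by rewrite mulr_sumr; apply: eq_bigr.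
ring.
Qed.

Lemma sink_alg (htt ht lt c gg gy H L : R) : lt = ht - c -> L = 0 ->
  htt * gg + ht * (0 + lt * gy) + lt * (H * L + gy) = htt * gg + (ht - c) * (ht + 1) * gy.
Proof. by move=> -> ->; ring. Qed.

(** The field y grad g has divergence y Delta g + g_y, which is g_y on the boundary graph. The
    factor [Dt h + 1] collects [Dt h] from the chain rule in the first term and 1 from this
    divergence; both come with the speed [Dt h - c] of the sinking graph. *)
Lemma is_derive_sink h g c t : C2 h -> (forall s, ww_periodic (fun x => h (s, x))) ->
  harm (fun x => h (t, x)) g ->
  is_derive t (1:R) (fun s => ww_tint (fun x => Dt h (s, x) * g (x, sink h c t (s, x)) +
    normal_flux (fun x => sink h c t (s, x)) (fun i (p : 'rV[R]_n * R) => p.2 * Dx i g p) (fun p : 'rV[R]_n * R => p.2 * Dy g p) x))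
  (ww_tint (fun x => Dt (Dt h) (t, x) * g (x, h (t, x)) +
     (Dt h (t, x) - c) * (Dt h (t, x) + 1) * Dy g (x, h (t, x)))).
Proof.
move=> ch ph hg; have [cg pg lg _] := hg.
pose l := sink h c t; have cl : C2 l by exact: C2_sink.
have cl1 := C2_C1 cl; have cht : C1 (Dt h) by exact: C2_D.
have csnd : C1 (fun p : 'rV[R]_n * R => p.2) by exact: (C2_C1 (C2_comp_snd _ (C2_id R))).
have cX v : C1 (fun p : 'rV[R]_n * R => p.2 * 'D_v g p) by exact: (C1M csnd (C2_D _ cg)).
have pX i : periodicx (fun p : 'rV[R]_n * R => p.2 * Dx i g p).
  by move=> j x y; rewrite (periodicx_derive _ pg).
have pl s : ww_periodic (fun x => l (s, x)).
  by move=> i x; rewrite /l /sink -[in RHS](ph s i x).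
have lt x : l (t, x) = h (t, x) by rewrite /l /sink /= subrr mulr0 addr0.
pose G (p : R * 'rV[R]_n) := g (p.2, l p).
have cG : C1 G by exact: (C1_graph (a := snd) (fun w => is_diff_snd w) cl1 (C2_C1 cg)).
have cgD : C1 (fun p => Dt h p * G p) by exact: (C1M cht cG).
have d1 := is_derive_tint t cgD.
have d2 := is_derive_flux t (fun i => cX (ww_ei i, 0)) (cX _ : C1 (fun p : 'rV[R]_n * R => p.2 * Dy g p)) cl pX pl.
have csl (q : R * 'rV[R]_n -> R) s : continuous q -> continuous (fun x => q (s, x)).
  by move=> cq; exact: (continuous_compT (@continuous_pair_cstl _ _ s) cq).
have NF s : normal_flux (fun x => l (s, x)) (fun i (p : 'rV[R]_n * R) => p.2 * Dx i g p) (fun p : 'rV[R]_n * R => p.2 * Dy g p) =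
    fun x => (fun p : 'rV[R]_n * R => p.2 * Dy g p) (x, l (s, x)) -
       \sum_i 'D_(0, ww_ei i) l (s, x) * (fun p : 'rV[R]_n * R => p.2 * Dx i g p) (x, l (s, x)).
  apply/funext => x; apply: (f_equal2 (fun a b => a - b)) => //.
  by apply: eq_bigr => i _; rewrite derive_slice.
have cNF s : continuous (normal_flux (fun x => l (s, x)) (fun i (p : 'rV[R]_n * R) => p.2 * Dx i g p)
    (fun p : 'rV[R]_n * R => p.2 * Dy g p)).
  exact: (@continuous_normal_flux _ _ (fun x => l (s, x)) _ _ (C2_slice s cl)
    (fun i => cX _) (cX _)).
have dsnd v p : 'D_v (fun p : 'rV[R]_n * R => p.2) p = v.2.
  by rewrite (@derive_affine R _ _ (fun p : 'rV[R]_n * R => p.2) (fun p => p.2) id) ?derive_id.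
have dX v p : 'D_v (fun p : 'rV[R]_n * R => p.2 * 'D_v g p) p = v.2 * 'D_v g p + p.2 * 'D_v ('D_v g) p.
  by rewrite (C1_DM _ _ csnd (C2_D _ cg)) dsnd.
have divE p : div (fun i (p : 'rV[R]_n * R) => p.2 * Dx i g p) (fun p : 'rV[R]_n * R => p.2 * Dy g p) p =
    p.2 * ww_lap_xy g p + Dy g p.
  apply: sink_div_alg => [i|]; first by rewrite dX mul0r add0r.
  by rewrite dX mul1r.
have cdiv : continuous (div (fun i (p : 'rV[R]_n * R) => p.2 * Dx i g p)
    (fun p : 'rV[R]_n * R => p.2 * Dy g p)).
  apply: continuousD_fun; last exact: (C1_continuousD (cX _)).
  by apply: continuous_sum_fun => i; exact: (C1_continuousD (cX _)).
have ctl (q : 'rV[R]_n * R -> R) : continuous q -> continuous (fun x => q (x, l (t, x))).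
  move=> cq; apply: continuous_compT cq.
  by apply: continuous_pair => [x|]; [exact: cvg_id|exact: (csl _ t (C1_continuous cl1))].
have cA : continuous (fun x => Dt (fun p => Dt h p * G p) (t, x)).
  exact: (csl _ t (C1_continuousD cgD)).
have cB : continuous (fun x => Dt l (t, x) *
    div (fun i (p : 'rV[R]_n * R) => p.2 * Dx i g p) (fun p : 'rV[R]_n * R => p.2 * Dy g p) (x, l (t, x))).
  apply: continuousM_fun; first exact: (csl _ t (C1_continuousD cl1)).
  exact: (ctl _ cdiv).
have E0 : ww_tint (fun x => Dt (Dt h) (t, x) * g (x, h (t, x)) +
     (Dt h (t, x) - c) * (Dt h (t, x) + 1) * Dy g (x, h (t, x))) =
   ww_tint (fun x => Dt (fun p => Dt h p * G p) (t, x)) +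
   ww_tint (fun x => Dt l (t, x) *
    div (fun i (p : 'rV[R]_n * R) => p.2 * Dx i g p) (fun p : 'rV[R]_n * R => p.2 * Dy g p) (x, l (t, x))).
  rewrite -tintD//; apply: eq_tint_cube.
  - have cth (q : 'rV[R]_n * R -> R) : continuous q -> continuous (fun x => q (x, h (t, x))).
      move=> cq; apply: continuous_compT cq.
      by apply: continuous_pair => [x|]; [exact: cvg_id|exact: (csl _ t (C1_continuous (C2_C1 ch)))].
    have cht' := csl _ t (C1_continuous cht).
    apply: continuousD_fun; apply: continuousM_fun.
    + exact: (csl _ t (C1_continuousD cht)).
    + exact: (cth _ (C1_continuous (C2_C1 cg))).
    + by apply: continuousM_fun; [apply: continuousB_fun|apply: continuousD_fun] => //;
        exact: cst_continuous.
    + exact: (cth _ (C1_continuousD (C2_C1 cg))).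
  - by apply: continuousD_fun.
  - move=> x cx; rewrite divE /= lt; apply/esym.
    (* [snd] sends the time direction to 0, so the horizontal term is a derivative along the zero
       vector. *)
    have dG : Dt G (t, x) = 'D_(0, 0) g (x, l (t, x)) + Dt l (t, x) * Dy g (x, l (t, x)).
      exact: (derive_graph _ _ (fun w => is_diff_snd w) cl1 (C2_C1 cg)).
    rewrite (C1_DM _ _ cht cG) dG (derive0 g) /G /= lt.
    exact: (sink_alg _ _ _ _ (derive_sink c t (t, x) ch) (harm_lap0 hg cx)).
rewrite E0.
have -> : (fun s => ww_tint (fun x => Dt h (s, x) * g (x, sink h c t (s, x)) +
    normal_flux (fun x => sink h c t (s, x)) (fun i (p : 'rV[R]_n * R) => p.2 * Dx i g p)
      (fun p : 'rV[R]_n * R => p.2 * Dy g p) x)) =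
  (fun s => ww_tint (fun x => (fun p => Dt h p * G p) (s, x)) +
    ww_tint (fun x => (fun p : 'rV[R]_n * R => p.2 * Dy g p) (x, l (s, x)) -
       \sum_i 'D_(0, ww_ei i) l (s, x) * (fun p : 'rV[R]_n * R => p.2 * Dx i g p) (x, l (s, x)))).
  apply/funext => s; rewrite -NF -tintD//.
  exact: (csl _ s (C1_continuous cgD)).
exact: (@is_deriveD _ _ _ _ _ _ _ _ _ d1 d2).
Qed.
End evolution.

(** * Choice and elimination of the sinking speed *)

Section duality.
Context {R : realType} {n : nat}.
Implicit Types (f g : 'rV[R]_n * R -> R) (h : R * 'rV[R]_n -> R).
Local Notation Dx i f := ('D_(ww_ei i, 0) f).
Local Notation Dy f := ('D_(0, 1) f).
Local Notation Dt h := ('D_(1, 0) h).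

Definition solution (T : R) h : Prop :=
  forall t, 0 <= t <= T ->
     exists phi, ww_harmonic_ext (fun x => h (t, x)) (fun x => h (t, x)) phi /\
       forall x, ww_dt h (t, x) + ww_DN (fun x => h (t, x)) phi x = 0.

(** Source of the speed [c]: the constant is the maximum of |h_t| on the compact product of [0, T]
    and the cube. *)
Lemma cube_lipschitz h (T : R) : 0 <= T -> C1 h ->
  exists2 C, 0 <= C & forall s s' x, 0 <= s -> s <= s' -> s' <= T -> cube x ->
    `|h (s', x) - h (s, x)| <= C * (s' - s).
Proof.
move=> T0 ch.
have cn : {within `[0, T]%classic `*` @cube R n, continuous (fun p => `|Dt h p|)}.
  apply: continuous_subspaceT.
  exact: (continuous_compT (C1_continuousD ch) (@norm_continuous R R)).
have cpt := compact_setX (@segment_compact R 0 T) (@compact_cube R n).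
have [|p _ hp] := @compact_EVT_max _ R (fun p => `|Dt h p|) _ _ cpt cn.
  by exists (0, 0); split; [rewrite /= in_itv /= lexx T0|exact: cube0].
exists `|Dt h p|; first exact: normr_ge0.
move=> s s' x s0 ss' s'T cx.
have dh r : is_derive r (1:R) (fun r : R => h (r, x)) (Dt h (r, x)).
  apply: (@is_derive_curve _ _ h (fun s : R => (s, x)) (1, 0) r).
    by move=> a; congr (_, _); rewrite /= ?scaler0 ?add0r// [a *: 1]mulr1.
  exact: C1_derivable.
have [|r] := @MVT_segment R (fun r => h (r, x)) _ s s' ss' (fun r _ => dh r).
  apply: continuous_subspaceT => r.
  by apply: differentiable_continuous; apply/derivable1_diffP; have [] := dh r.
rewrite in_itv /= => /andP[sr rs'] ->.
rewrite normrM (ger0_norm (_ : 0 <= s' - s)) ?subr_ge0//; apply: ler_wpM2r; first by rewrite subr_ge0.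
apply: hp; rewrite inE; split => //=.
by rewrite in_itv /= (le_trans s0 sr) (le_trans rs' s'T).
Qed.

Lemma sink_zero (T c t s : R) h g : C2 h -> (forall t, ww_periodic (fun x => h (t, x))) ->
  solution T h -> harm (fun x => h (t, x)) g -> 0 <= s <= T ->
  (forall x, cube x -> h (s, x) - c * (s - t) <= h (t, x)) ->
  ww_tint (fun x => Dt h (s, x) * g (x, sink h c t (s, x)) +
    normal_flux (fun x => sink h c t (s, x)) (fun i (p : 'rV[R]_n * R) => p.2 * Dx i g p)
      (fun p : 'rV[R]_n * R => p.2 * Dy g p) x) = 0.
Proof.
move=> ch ph sol hg sT hle; have [f [ext DN]] := sol s sT.
have hf := harm_of_ext ext; have [_ _ _ _ fh] := ext.
rewrite -[RHS](green_trace (C2_slice s ch) (ph s) hf hg hle fh DN).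
have -> : (fun x => sink h c t (s, x)) = (fun x => h (s, x) - c * (s - t)).
  by apply/funext => x; rewrite /sink mulNr.
by congr ww_tint; apply/funext => x; rewrite /sink mulNr.
Qed.

(** For [t < T] the speed [C] keeps the lowered graph below that of time [t] at all later times up
    to [T]; at [t = T] the speed [- C] does so at earlier times. The value of [c] stays existential
    because it drops out of the final identity. *)
Lemma shift_identity (T t : R) h g : C2 h -> (forall t, ww_periodic (fun x => h (t, x))) ->
  0 < T -> solution T h -> harm (fun x => h (t, x)) g -> 0 <= t <= T ->
  exists c, ww_tint (fun x => Dt (Dt h) (t, x) * g (x, h (t, x)) +
     (Dt h (t, x) - c) * (Dt h (t, x) + 1) * Dy g (x, h (t, x))) = 0.
Proof.
move=> ch ph T0 sol hg /andP[t0 tT].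
have [C C0 lip] := cube_lipschitz (ltW T0) (C2_C1 ch).
have [tltT|Tt] := ltP t T.
- exists C; apply: (is_derive_right0 (is_derive_sink C ch ph hg) (_ : 0 < T - t)).
    by rewrite subr_gt0.
  move=> s /andP[ts]; rewrite addrC subrK => sT.
  apply: (sink_zero ch ph sol hg); first by rewrite sT (le_trans t0 ts).
  move=> x cx; have := lip t s x t0 ts sT cx.
  by rewrite ler_norml => /andP[_]; lra.
- have {tT Tt} tT : t = T by apply/eqP; rewrite eq_le tT Tt.
  exists (- C); apply: (is_derive_left0 (is_derive_sink (- C) ch ph hg) T0).
  move=> s /andP[]; rewrite tT subrr => s0 sT.
  rewrite tT in hg.
  apply: (sink_zero ch ph sol hg); first by rewrite s0.
  move=> x cx; have := lip s T x s0 sT (lexx T) cx.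
  by rewrite ler_norml => /andP[+ _]; lra.
Qed.

(** The coefficients of [gy] combine through (ht - c)(ht + 1) + (c - 1)(1 + ht) = ht^2 - 1, and the
    flux of grad g restores the missing [gy]. Its horizontal part cancels against the one in [L]. *)
Lemma duality_alg (I : finType) (hii hi gi L : I -> R) (htt ht g gy c : R) :
  (forall i, L i = hii i * g + hi i * (gi i + hi i * gy)) ->
  (htt + \sum_i hii i) * g + (ht ^+ 2 + \sum_i hi i ^+ 2) * gy =
  (htt * g + (ht - c) * (ht + 1) * gy) + (c - 1) * ((1 + ht) * gy) +
  (gy - \sum_i hi i * gi i) + \sum_i L i.
Proof.
move=> LE.
have -> : \sum_i L i = (\sum_i hii i) * g + \sum_i hi i * gi i + (\sum_i hi i ^+ 2) * gy.
  by rewrite !mulr_suml -!big_split /=; apply: eq_bigr => i _; rewrite LE; ring.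
ring.
Qed.

End duality.

Theorem theorem1p2 (R : realType) (n : nat) (T : R) (h : R * 'rV[R]_n -> R) :
  (1 <= n)%N -> 0 < T ->
  ww_smooth h ->
  (forall t, ww_periodic (fun x => h (t, x))) ->
  (* h solves  d_t h + G(h) h = 0  on [0,T] x T^n *)
  (forall t, 0 <= t <= T ->
     exists phi, ww_harmonic_ext (fun x => h (t, x)) (fun x => h (t, x)) phi /\
       forall x, ww_dt h (t, x) + ww_DN (fun x => h (t, x)) phi x = 0) ->
  (* conclusion:  Delta_{t,x} h + B(h)^* (|nabla_{t,x} h|^2) = 0, i.e. for every
     ww_smooth psi on T^n,  <Delta h, psi> + <|nabla h|^2, B(h) psi> = 0 in L^2(T^n) *)
  forall t, 0 <= t <= T ->
  forall (psi : 'rV[R]_n -> R) (phi : 'rV[R]_n * R -> R),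
    ww_smooth psi -> ww_periodic psi ->
    ww_harmonic_ext (fun x => h (t, x)) psi phi ->
    ww_tint (fun x => ww_lap_tx h (t, x) * psi x
                   + ww_gradsq_tx h (t, x) * ww_Bop (fun x => h (t, x)) phi x) = 0.
Proof.
move=> _ T0 sh ph sol t tT psi phi _ _ ext.
have ch := smooth_C2 sh; have hg := harm_of_ext ext; have [cg pg _ _] := hg.
have [_ _ _ _ gpsi] := ext; have [f [extf DN]] := sol t tT.
have hf := harm_of_ext extf; have [_ _ _ _ fh] := extf.
have cht := C2_slice t ch.
have [c S0] := shift_identity ch ph T0 sol hg tT.
have N0 := noether_trace cht (ph t) hf hg fh DN.
have F0 := flux_harm cht (ph t) hg.
have csl (q : R * 'rV[R]_n -> R) : continuous q -> continuous (fun x => q (t, x)).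
  by move=> cq; exact: (continuous_compT (@continuous_pair_cstl _ _ t) cq).
pose tr (q : 'rV[R]_n * R -> R) x := q (x, h (t, x)).
have ctr q : C1 q -> C1 (tr q).
  by move=> cq; exact: (C1_graph (a := id) (fun w => is_diff_id w) (C2_C1 cht) cq).
have chi i : C1 (fun x => 'D_(0, ww_ei i) h (t, x)) by exact: (C1_slice t (C2_D _ ch)).
(* Total derivative along the graph of h_{x_i} times the trace of [phi]. It integrates to zero on
   the torus and supplies both the term with Delta_x h and the one with the squared spatial
   gradient. *)
pose L i x := 'D_(ww_ei i) (fun x => 'D_(0, ww_ei i) h (t, x) * tr phi x) x.
have cL i : C1 (fun x => 'D_(0, ww_ei i) h (t, x) * tr phi x).
  exact: (C1M (chi i) (ctr _ (C2_C1 cg))).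
have L0 i : ww_tint (L i) = 0.
  apply: tint_derive_periodic.
  - exact: (C1_continuous (cL i)).
  - by move=> x; exact: (@C1_derivable _ _ _ x (ww_ei i) (cL i)).
  - exact: (C1_continuousD (cL i)).
  - move=> x; have ph' : h (t, x + ww_ei i) = h (t, x) by exact: (ph t i x).
    rewrite /tr ph' pg; congr (_ * _).
    by rewrite -!derive_slice (derive_translate _ _ (ph t i)).
pose A x := 'D_(1, 0) ('D_(1, 0) h) (t, x) * phi (x, h (t, x)) +
  ('D_(1, 0) h (t, x) - c) * ('D_(1, 0) h (t, x) + 1) * 'D_(0, 1) phi (x, h (t, x)).
pose N x := (1 + ww_dt h (t, x)) * 'D_(0, 1) phi (x, h (t, x)).
pose F := normal_flux (fun x => h (t, x)) (fun i => 'D_(ww_ei i, 0) phi) ('D_(0, 1) phi).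
have E x : ww_lap_tx h (t, x) * psi x + ww_gradsq_tx h (t, x) * ww_Bop (fun x => h (t, x)) phi x =
    A x + (c - 1) * N x + F x + \sum_i L i x.
  rewrite -gpsi /F /normal_flux; under [in RHS]eq_bigr do rewrite derive_slice.
  apply: duality_alg => i.
  rewrite /L (C1_DM _ _ (chi i) (ctr _ (C2_C1 cg))).
  have -> := derive_slice (fun p => 'D_(0, ww_ei i) h p) t x (ww_ei i).
  by rewrite (derive_trace _ _ cht cg) (derive_slice h).
have c1 : continuous (fun x => 'D_(1, 0) h (t, x)) by exact: (csl _ (C1_continuousD (C2_C1 ch))).
have cdy : continuous (tr ('D_(0, 1) phi)) by exact: (C1_continuous (ctr _ (C2_D _ cg))).
have ccst (a : R) : continuous (fun _ : 'rV[R]_n => a) by exact: cst_continuous.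
have cA : continuous A.
  apply: continuousD_fun; apply: continuousM_fun.
  - exact: (csl _ (C1_continuousD (C2_D _ ch))).
  - exact: (C1_continuous (ctr _ (C2_C1 cg))).
  - by apply: continuousM_fun; [exact: continuousB_fun|exact: continuousD_fun].
  - exact: cdy.
have cN : continuous N by apply: continuousM_fun => //; exact: continuousD_fun.
have cF : continuous F.
  exact: (@continuous_normal_flux _ _ _ _ _ cht (fun i => C2_D _ cg) (C2_D _ cg)).
have cLi i : continuous (L i) by exact: (C1_continuousD (cL i)).
have ccN : continuous (fun x => (c - 1) * N x) by exact: continuousM_fun.
have cAN := continuousD_fun cA ccN; have cANF := continuousD_fun cAN cF.
rewrite (_ : (fun x => _) = fun x => A x + (c - 1) * N x + F x + \sum_i L i x); last first.
  by apply/funext => x; exact: E.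
rewrite tintD//; last exact: continuous_sum_fun.
rewrite tintD// tintD// tintZ// tint_sum// S0 N0 F0 mulr0 !addr0 add0r.
by rewrite big1.
Qed.
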